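(* Let $\mu$ be a directed distance on $S$. (1) $\mathrm{MFP}^*(\mu;G,S,c)=\mathrm{FLP}^*(R;G,S,c)$ for every slimmed section $R$ in $(Q^{slim}_\mu)^+$ and every network $(G,S,c)$ that is properly inner Eulerian relative to $\mu$. (2) $\mathrm{MFP}^*(\mu;G,S,c)=\mathrm{FLP}^*(R;G,S,c)$ for every slimmed section $R$ in $Q^{slim}_\mu$ and every totally Eulerian network $(G,S,c)$.
   Context: Networks and multiflows: a network $(G,S,c)$ is a finite digraph $G=(VG,EG)$, terminal set $S\subseteq VG$, capacity $c:EG\to\mathbb Z_+$; a multiflow is a set $\mathcal P$ of directed paths joining distinct terminals with weights $\lambda\ge0$ obeying $\sum_{P\ni e}\lambda(P)\le c(e)$. A directed distance is $\mu:S\times S\to\mathbb R_+$ with zero diagonal; $\mathrm{MFP}^*(\mu;G,S,c)$ is the maximum over multiflows of $\sum_P\lambda(P)\mu(s_P,t_P)$ (start, end of $P$). A node fulfills the Eulerian condition if its outgoing capacity equals its incoming capacity; the network is totally Eulerian if every node does. Let $S^c,S^r$ be disjoint copies of $S$ ($s^c,s^r$; $X^c,X^r$ for $X\subseteq S$), $S^{cr}=S^c\cup S^r$, $p^c,p^r$ the restrictions of $p\in\mathbb R^{S^{cr}}$. $p\le q$ is coordinatewise, $p<q$ is strict in all coordinates. $P_\mu=\{p:p(s^c)+p(t^r)\ge\mu(s,t)\ \forall s,t\}$; $Q_\mu$ = set of minimal points of $P_\mu$. For a set $A$, $A^+$ is its set of nonnegative points. $L=\mathbb R(\mathbf 1,-\mathbf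 1)$ ($1$ on $S^c$, $-1$ on $S^r$). $D^+_\infty(p,q)=\max_x\max\{q(x)-p(x),0\}$; $D_\infty(p,q)=\max\{D^+_\infty(p^c,q^c),D^+_\infty(q^r,p^r)\}$. For $R\subseteq P_\mu$, $R_s=\{p\in R:p(s^c)+p(s^r)=0\}$ and $\mathrm{FLP}^*(R;G,S,c)$ is the minimum of $\sum_{xy\in EG}c(xy)D_\infty(\rho(x),\rho(y))$ over maps $\rho:VG\to R$ with $\rho(s)\in R_s$ ($s\in S$). For $p\in Q_\mu$, $K(p)$ is the bipartite graph on $S^{cr}$ with edges $s^ct^r$ where $p(s^c)+p(t^r)=\mu(s,t)$; $N_p(U)$ is the set of nodes outside $U$ adjacent to $U$. $\mathcal S_0$ = family of $X\subseteq S$ with $\mu(s,t)=0$ for $s,t\in X$. For $X\in\mathcal S_0$: $Q_{\mu,X}$ = points $p\in Q_\mu$ with ($s^cs^r\in EK(p)\iff s\in X$); $p$ is a fat relative to $X$ if $p\in Q_{\mu,X}$ and $N_p(S^c\setminus X^c)\subseteq S^r\setminus X^r$ or $N_p(S^r\setminus X^r)\subseteq S^c\setminus X^c$; $Q^{deg}_{\mu,X}$ = points of $Q_{\mu,X}$ with one of these inclusions an equality. A proper fat is a fat in no degenerate set. $Q^{slim}_\mu$ = $Q_\mu$ minus proper fats. On it, $p\sim q$ if $p-q\in L$, or both lie in some $Q^{deg}_{\mu,X}$ and $p-q\in L+\mathbb R(\mathbf 1_{X^c},-\mathbf 1_{X^r})$; $\bar Q^{slim}_\mu=Q^{slim}_\mu/\sim$.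 A set $R$ is balanced if no $p,q\in R$ have $p^c<q^c$ or $p^r<q^r$. A slimmed section in $(Q^{slim}_\mu)^+$ is a balanced subset $R\subseteq(Q^{slim}_\mu)^+$ mapped bijectively onto $\bar Q^{slim}_\mu$ by the quotient map, such that for each $X\in\mathcal S_0$ there are no $p,q\in R\cap(Q^{deg}_{\mu,X})^+$ with $p(s^c)<q(s^c)$ for all $s^c\in S^c\setminus X^c$ or $p(s^r)<q(s^r)$ for all $s^r\in S^r\setminus X^r$. A slimmed section in $Q^{slim}_\mu$ is a balanced subset $R\subseteq Q^{slim}_\mu$ mapped bijectively onto $\bar Q^{slim}_\mu$ such that $R/L=R'/L$ for some slimmed section $R'$ in $(Q^{slim}_\mu)^+$. A terminal $s$ is proper if $(Q_\mu)_s$ contains no fat (relative to any $X\in\mathcal S_0$). The network is properly inner Eulerian (relative to $\mu$) if every node other than the proper terminals fulfills the Eulerian condition. *)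

(* Defs.v *)
From mathcomp Require Import all_boot all_order all_algebra finmap.
From mathcomp Require Import boolp classical_sets functions reals.

Set Implicit Arguments.
Unset Strict Implicit.
Unset Printing Implicit Defensive.

Import Order.TTheory GRing.Theory Num.Theory.

Local Open Scope classical_set_scope.
Local Open Scope ring_scope.

(* The terminal set S is an abstract finite type, embedded in the node set by
   an injection, so that the distance mu on S can be fixed before the network.
   An edge is an ordered pair of nodes; the values of the capacity outside
   [edges] play no role. *)
Record network (S : finType) := Network {
  node : finType;
  edges : {set node * node};
  term : S -> node;
  term_inj : injective term;
  cap : node * node -> nat
}.

Arguments edges {S} _.
Arguments term {S} _ _.
Arguments cap {S} _ _.

Section Networks.
Variables (R : realType) (S : finType).
Implicit Types (mu : S -> S -> R) (N : network S).

Definition directed_distance mu : Prop :=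
  (forall s t, 0 <= mu s t) /\ (forall s, mu s s = 0).

(* A triple (s, t, w) stands for the path whose node sequence is
   [term s :: w] and whose last node is [term t]. *)
Definition terminal_path N (P : S * S * seq (node N)) : bool :=
  let: (s, t, w) := P in
  [&& s != t, path (fun x y => (x, y) \in edges N) (term N s) w,
      last (term N s) w == term N t & uniq (term N s :: w)].

Definition path_edges N (P : S * S * seq (node N)) : seq (node N * node N) :=
  let: (s, _, w) := P in zip (term N s :: w) w.

Definition multiflow N (Ps : {fset S * S * seq (node N)})
    (lam : S * S * seq (node N) -> R) : Prop :=
  [/\ forall P, P \in Ps -> terminal_path P,
      forall P, P \in Ps -> 0 <= lam P &
      forall e, e \in edges N ->
        \sum_(P <- Ps | e \in path_edges P) lam P <= (cap N e)%:R].

Definition flow_value mu N (Ps : {fset S * S * seq (node N)})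
    (lam : S * S * seq (node N) -> R) : R :=
  \sum_(P <- Ps) lam P * mu P.1.1 P.1.2.

Definition flow_values mu N : set R :=
  [set v | exists Ps lam, multiflow (N := N) Ps lam /\ v = flow_value mu Ps lam].

Definition is_MFP mu N (v : R) : Prop :=
  flow_values mu N v /\ ubound (flow_values mu N) v.

Definition eulerian_at N (x : node N) : Prop :=
  (\sum_(e in edges N | e.1 == x) cap N e =
   \sum_(e in edges N | e.2 == x) cap N e)%N.

Definition totally_eulerian N : Prop := forall x : node N, eulerian_at x.

End Networks.

(* Points of R^(S^cr): [inl s] is the copy s^c and [inr s] is the copy s^r. *)
Definition crpoint (R : realType) (S : finType) := {ffun S + S -> R}.

Section Points.
Variables (R : realType) (S : finType).
Implicit Types (mu : S -> S -> R) (p q : crpoint R S) (A B : set (crpoint R S)).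
Implicit Types (X : {set S}) (U : {set S + S}).

Definition copyc X : {set S + S} := inl @: X.
Definition copyr X : {set S + S} := inr @: X.

Definition le_pt p q : Prop := forall x, p x <= q x.

Definition nonneg A : set (crpoint R S) := [set p | A p /\ forall x, 0 <= p x].

(* The vector a (1_(X^c), - 1_(X^r)). *)
Definition pm_ind (a : R) X : crpoint R S :=
  [ffun x => match x with
             | inl s => a * (s \in X)%:R
             | inr s => - (a * (s \in X)%:R)
             end].

Definition line : set (crpoint R S) := [set p | exists a : R, p = pm_ind a [set: S]%SET].

Definition coset_line p : set (crpoint R S) := [set q | line (q - p)].
Definition mod_line A : set (set (crpoint R S)) := coset_line @` A.

Definition Dplus (f g : S -> R) : R :=
  \big[Num.max/0]_(s : S) Num.max (g s - f s) 0.

Definition Dinf p q : R :=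
  Num.max (Dplus (fun s => p (inl s)) (fun s => q (inl s)))
          (Dplus (fun s => q (inr s)) (fun s => p (inr s))).

Definition P_ mu : set (crpoint R S) :=
  [set p | forall s t, mu s t <= p (inl s) + p (inr t)].

Definition Q_ mu : set (crpoint R S) :=
  [set p | P_ mu p /\ forall q, P_ mu q -> le_pt q p -> q = p].

Definition at_terminal A (s : S) : set (crpoint R S) :=
  [set p | A p /\ p (inl s) + p (inr s) = 0].

Definition location A (N : network S) (rho : node N -> crpoint R S) : Prop :=
  (forall x, A (rho x)) /\ (forall s, at_terminal A s (rho (term N s))).

Definition location_cost (N : network S) (rho : node N -> crpoint R S) : R :=
  \sum_(e in edges N) (cap N e)%:R * Dinf (rho e.1) (rho e.2).

Definition location_costs A (N : network S) : set R :=
  [set v | exists rho, location (N := N) A rho /\ v = location_cost rho].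

Definition is_FLP A (N : network S) (v : R) : Prop :=
  location_costs A N v /\ lbound (location_costs A N) v.

(* The edge relation of the bipartite graph K(p) on S^cr. *)
Definition K_adj mu p : rel (S + S) := fun x y =>
  match x, y with
  | inl s, inr t | inr t, inl s => p (inl s) + p (inr t) == mu s t
  | _, _ => false
  end.

Definition neighbors mu p U : {set S + S} :=
  finset (fun x => (x \notin U) && [exists y in U, K_adj mu p y x]).

Definition S0 mu X : Prop := forall s t, s \in X -> t \in X -> mu s t = 0.

Definition QX mu X : set (crpoint R S) :=
  [set p | Q_ mu p /\ forall s, K_adj mu p (inl s) (inr s) <-> s \in X].

Definition fat mu X : set (crpoint R S) :=
  [set p | QX mu X p /\
    (neighbors mu p (copyc (~: X)) \subset copyr (~: X) \/
     neighbors mu p (copyr (~: X)) \subset copyc (~: X))].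

Definition Qdeg mu X : set (crpoint R S) :=
  [set p | QX mu X p /\
    (neighbors mu p (copyc (~: X)) = copyr (~: X) \/
     neighbors mu p (copyr (~: X)) = copyc (~: X))].

Definition proper_fat mu : set (crpoint R S) :=
  [set p | (exists X, S0 mu X /\ fat mu X p) /\
           ~ (exists X, S0 mu X /\ Qdeg mu X p)].

Definition Qslim mu : set (crpoint R S) := Q_ mu `\` proper_fat mu.

Definition slim_equiv mu p q : Prop :=
  line (p - q) \/
  exists X, [/\ S0 mu X, Qdeg mu X p, Qdeg mu X q &
    exists a : R, line (p - q - pm_ind a X)].

(* The quotient of Qslim by ~ is the set of ~-classes. *)
Definition slim_class mu p : set (crpoint R S) :=
  [set q | Qslim mu q /\ slim_equiv mu p q].
Definition Qslim_bar mu : set (set (crpoint R S)) := slim_class mu @` Qslim mu.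

Definition balanced A : Prop :=
  forall p q, A p -> A q ->
    ~ (forall s, p (inl s) < q (inl s)) /\ ~ (forall s, p (inr s) < q (inr s)).

Definition slimmed_section_nonneg mu A : Prop :=
  [/\ balanced A, A `<=` nonneg (Qslim mu),
      set_bij A (Qslim_bar mu) (slim_class mu) &
      forall X, S0 mu X -> forall p q,
        (A `&` nonneg (Qdeg mu X)) p -> (A `&` nonneg (Qdeg mu X)) q ->
        ~ (forall s, s \notin X -> p (inl s) < q (inl s)) /\
        ~ (forall s, s \notin X -> p (inr s) < q (inr s))].

Definition slimmed_section mu A : Prop :=
  [/\ balanced A, A `<=` Qslim mu,
      set_bij A (Qslim_bar mu) (slim_class mu) &
      exists B, slimmed_section_nonneg mu B /\ mod_line A = mod_line B].

Definition proper_terminal mu (s : S) : Prop :=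
  ~ exists p X, [/\ at_terminal (Q_ mu) s p, S0 mu X & fat mu X p].

Definition properly_inner_eulerian mu (N : network S) : Prop :=
  forall x : node N,
    ~ (exists s, x = term N s /\ proper_terminal mu s) -> eulerian_at x.

(* MFP* = FLP*, including that the maximum and the minimum are attained. *)
Definition MFP_eq_FLP mu A (N : network S) : Prop :=
  exists v, is_MFP mu N v /\ is_FLP A N v.

End Points.

(* Main.v *)
Require Import Defs.
From mathcomp Require Import all_boot all_order all_algebra.
From mathcomp Require Import boolp classical_sets functions reals.
From mathcomp Require Import finmap lra ring.

(* By LP duality, MFP* is the minimum of sum c(e) l(e) over edge lengths l >= 0
   for which every terminal path from s to t has length at least mu(s, t). The
   distances from and to the terminals turn l into a map to P_mu^+ whose
   D_infinity-lengths are bounded by l; conversely the D_infinity-length of any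
   path between located terminals bounds mu, which is weak duality.

   The map to P_mu^+ is then pushed into the section. On Q_mu the asymmetric
   distance is the largest q(s^c) - p(s^c), a function of the c-parts alone, and
   f |-> max(f, a(f)), with a(f) the minimum of max(f(s), f(t) - mu(t, s)) over
   the pairs with mu(t, s) > 0, is a contraction of the c-parts which collapses
   the fats of one kind and fixes all other points. Applied to c-parts and then to
   r-parts it retracts Q_mu to the slim points. Finally, passing to
   representatives in R moves the points along L, which adds a potential
   difference to each edge: the sum of these vanishes since the potential is zero
   at the proper terminals and the other nodes are Eulerian.

   For totally Eulerian networks the same potential argument shows that FLP*(R)
   depends only on R/L when R is balanced. *)

Set Implicit Arguments.
Unset Strict Implicit.
Unset Printing Implicit Defensive.

Import Order.TTheory GRing.Theory Num.Theory.

Local Open Scope ring_scope.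

(** * Linear programming duality *)

Section Cone.
Variables (R : realFieldType) (V : lmodType R).
Implicit Types (C : seq V) (u v w : V).

Inductive cone C : V -> Prop :=
| cone_nil : cone C 0
| cone_cons k v w : 0 <= k -> v \in C -> cone C w -> cone C (k *: v + w).

Lemma cone_mem C v : v \in C -> cone C v.
Proof.
by move=> vC; have := cone_cons ler01 vC (cone_nil C); rewrite scale1r addr0.
Qed.

Lemma coneD C v w : cone C v -> cone C w -> cone C (v + w).
Proof.
elim=> [|k u v' k0 uC _ IH] cw; first by rewrite add0r.
by rewrite -addrA; apply: cone_cons => //; apply: IH.
Qed.

Lemma coneZ C k v : 0 <= k -> cone C v -> cone C (k *: v).
Proof.
move=> k0; elim=> [|l u w l0 uC _ IH]; first by rewrite scaler0; constructor.
by rewrite scalerDr scalerA; apply: cone_cons => //; apply: mulr_ge0.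
Qed.

Lemma cone_trans C C' w :
  (forall v, v \in C' -> cone C v) -> cone C' w -> cone C w.
Proof.
move=> sub; elim=> [|k v u k0 vC' _ IH]; first by constructor.
by apply: coneD => //; apply: coneZ => //; apply: sub.
Qed.

Lemma cone_codom (K : finType) (F : K -> V) w :
  cone (codom F) w ->
  exists2 y : K -> R, forall k, 0 <= y k & w = \sum_k y k *: F k.
Proof.
elim=> [|k v u k0 /codomP[i ->] _ [y y0 ->]].
  by exists (fun=> 0) => //; rewrite big1 // => i _; rewrite scale0r.
exists (fun j => y j + (if j == i then k else 0)) => [j|].
  by rewrite addr_ge0 //; case: ifP.
under [RHS]eq_bigr do rewrite scalerDl.
rewrite big_split /= addrC; congr (_ + _).
rewrite (bigD1 i) //= eqxx big1 ?addr0 // => j /negPf ->.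
by rewrite scale0r.
Qed.

End Cone.

(** * Farkas' lemma by Fourier-Motzkin elimination *)

Section Farkas.
Variables (R : realFieldType) (I : finType).
Local Notation constraint := ({ffun I -> R^o} * R^o)%type.
Implicit Types (v : constraint) (C : seq constraint) (x : I -> R).

Definition sat x v := \sum_i v.1 i * x i <= v.2.

Lemma separating_point (ls us : seq R) :
  (forall l u, l \in ls -> u \in us -> l <= u) ->
  exists z, (forall l, l \in ls -> l <= z) /\ (forall u, u \in us -> z <= u).
Proof.
elim: ls => [_|l ls IH H].
  elim: us => [|u us [z [_ Hz]]]; first by exists 0.
  exists (Num.min u z); split=> // u'; rewrite inE => /predU1P[->|u'us].
    by rewrite ge_min lexx.
  by rewrite ge_min Hz ?orbT.
have [l' u' l'in u'in|z [Hl Hu]] := IH; first by apply: H; rewrite ?inE ?l'in ?orbT.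
exists (Num.max l z); split=> [l'|u uin].
  by rewrite inE => /predU1P[->|/Hl l'z]; rewrite le_max ?lexx // l'z orbT.
by rewrite ge_max Hu // H ?inE ?eqxx.
Qed.

(** Variables outside [vs] are already eliminated. Every constraint of the reduced system lies in
    the cone of the old one, so a contradiction left after all eliminations is a nonnegative
    combination of the original constraints. *)
Lemma farkas_aux (vs : seq I) C :
  (forall v, v \in C -> forall i, i \notin vs -> v.1 i = 0) ->
  (exists x, forall v, v \in C -> sat x v) \/
  (exists2 b : R, b < 0 & cone C ((0, b) : constraint)).
Proof.
elim: vs C => [|i vs IH] C HC.
  have [/allP H|/allPn[v vC]] := boolP (all (fun v => 0 <= v.2) C).
    left; exists (fun=> 0) => v vC; rewrite /sat big1 ?H // => j _.
    by rewrite mulr0.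
  rewrite -ltNge => v0; right; exists v.2 => //.
  suff -> : (0, v.2) = v by apply: cone_mem.
  case: v vC {v0} => a b /= vC; congr (_, _); apply/ffunP => j.
  by rewrite ffunE (HC _ vC).
pose pos := [seq v : constraint <- C | 0 < v.1 i].
pose neg := [seq v : constraint <- C | v.1 i < 0].
(* The multipliers [u.1 i] and [- w.1 i] are positive and cancel the coefficient of variable [i]. *)
pose mix (u w : constraint) := u.1 i *: w - w.1 i *: u.
pose C' := [seq v : constraint <- C | v.1 i == 0] ++ [seq mix u w | u <- pos, w <- neg].
have coneC' v : v \in C' -> cone C v.
  rewrite mem_cat => /orP[|/allpairsP[[u w] /= [uP wN ->]]].
    by rewrite mem_filter => /andP[_ /cone_mem].
  move: uP wN; rewrite !mem_filter => /andP[u0 uC] /andP[w0 wC].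
  rewrite /mix -scaleNr; apply: coneD; apply: coneZ; rewrite ?oppr_ge0 ?ltW //;
    exact: cone_mem.
have [v vC' j jvs||] := IH C'.
- have [->{jvs}|ji] := eqVneq j i.
    move: vC'; rewrite mem_cat => /orP[|/allpairsP[[u w] /= [_ _ ->]]].
      by rewrite mem_filter => /andP[/eqP].
    by rewrite /mix /= !ffunE /GRing.scale /=; ring.
  have jn : j \notin i :: vs by rewrite inE negb_or ji.
  move: vC'; rewrite mem_cat => /orP[|/allpairsP[[u w] /= [uP wN ->]]].
    by rewrite mem_filter => /andP[_ vC]; apply: HC.
  move: uP wN; rewrite !mem_filter => /andP[_ uC] /andP[_ wC].
  rewrite /mix /= !ffunE (HC _ uC j jn) (HC _ wC j jn).
  by rewrite /GRing.scale /=; ring.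
- case=> x xsat; left.
  (* With the other variables fixed, [bnd v] is the bound that [v] puts on variable [i]: a lower one
     for [neg], an upper one for [pos]. *)
  pose rest v := \sum_(j | j != i) v.1 j * x j.
  pose bnd v := (v.2 - rest v) / v.1 i.
  have [l u /mapP[w wN ->] /mapP[{}u uP ->]|z [Hl Hu]] :=
    @separating_point (map bnd neg) (map bnd pos).
    have /xsat : mix u w \in C'.
      by rewrite mem_cat; apply/orP; right; apply/allpairsP; exists (u, w).
    move: uP wN; rewrite !mem_filter => /andP[u0 uC] /andP[w0 wC].
    rewrite /sat (bigD1 i) //=.
    have -> : \sum_(j | j != i) (mix u w).1 j * x j =
              u.1 i * rest w - w.1 i * rest u.
      rewrite /rest !mulr_sumr -sumrB; apply: eq_bigr => j _.
      by rewrite /mix /= !ffunE /GRing.scale /=; ring.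
    rewrite /mix /= !ffunE /GRing.scale /= => H.
    rewrite /bnd ler_pdivlMr // mulrAC ler_ndivrMr //; lra.
  exists (fun j => if j == i then z else x j) => v vC.
  rewrite /sat (bigD1 i) //= eqxx.
  rewrite (eq_bigr (fun j => v.1 j * x j)); last by move=> j /negPf ->.
  rewrite -/(rest v); have [v0|v0|v0] := ltgtP (v.1 i) 0.
  + have /Hl : bnd v \in map bnd neg by apply: map_f; rewrite mem_filter v0.
    by rewrite /bnd ler_ndivrMr // mulrC; lra.
  + have /Hu : bnd v \in map bnd pos by apply: map_f; rewrite mem_filter v0.
    by rewrite /bnd ler_pdivlMr // mulrC; lra.
  + have /xsat : v \in C' by rewrite mem_cat mem_filter v0 eqxx vC.
    by rewrite /sat (bigD1 i) //= v0 !mul0r.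
- by case=> b b0 cb; right; exists b => //; apply: cone_trans cb.
Qed.

Lemma farkas (K : finType) (a : K -> I -> R) (b : K -> R) :
  (exists x, forall k, \sum_i a k i * x i <= b k) \/
  (exists y, [/\ forall k, 0 <= y k, forall i, \sum_k y k * a k i = 0 &
                 \sum_k y k * b k < 0]).
Proof.
pose F k : constraint := (finfun (a k), b k).
have [v _ i|[x Hx]|[c c0 /cone_codom[y y0 E]]] := @farkas_aux (enum I) (codom F).
- by rewrite mem_enum.
- left; exists x => k; have := Hx (F k) (codom_f _ _); rewrite /sat /=.
  by under eq_bigr do rewrite ffunE.
- right; exists y; split=> // [i|].
    transitivity ((\sum_k y k *: F k).1 i); last by rewrite -E ffunE.
    have -> : (\sum_k y k *: F k).1 = \sum_k y k *: (F k).1.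
      by elim/big_ind2: _ => // ? ? ? ? <- <-.
    by rewrite sum_ffunE; apply: eq_bigr => k _; rewrite !ffunE.
  suff <- : c = \sum_k y k * b k by [].
  rewrite [c](congr1 snd E).
  by elim/big_ind2: _ => // ? ? ? ? <- <-.
Qed.

End Farkas.

(** * Strong duality of linear programs *)

Section Duality.
Variables (R : realFieldType) (I J : finType).
Variables (A : I -> J -> R) (b : I -> R) (c : J -> R).

(** Feasibility of both programs and the reversed duality inequality form one linear system. By
    Farkas' lemma its failure yields multipliers, which violate weak duality or, if the multiplier
    [tau] of that inequality vanishes, contradict the feasible points [x0] and [y0]. *)
Lemma lp_duality (x0 : J -> R) (y0 : I -> R) :
  (forall j, 0 <= x0 j) -> (forall i, \sum_j A i j * x0 j <= b i) ->
  (forall i, 0 <= y0 i) -> (forall j, c j <= \sum_i A i j * y0 i) ->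
  exists x y, [/\ forall j, 0 <= x j, forall i, \sum_j A i j * x j <= b i,
    forall i, 0 <= y i, forall j, c j <= \sum_i A i j * y i &
    \sum_i b i * y i <= \sum_j c j * x j].
Proof.
move=> x0_ge0 Ax0 y0_ge0 Ay0.
(* The unknowns are [inl i] for [y i] and [inr j] for [x j]; the rows are the primal, dual, sign and
   optimality constraints. *)
pose a (k : (I + J) + ((I + J) + unit)) (v : I + J) : R :=
  match k, v with
  | inl (inl i), inr j => A i j
  | inl (inl i), inl _ => 0
  | inl (inr j), inl i => - A i j
  | inl (inr j), inr _ => 0
  | inr (inl k'), v => - (k' == v)%:R
  | inr (inr _), inl i => b i
  | inr (inr _), inr j => - c j
  end.
pose d (k : (I + J) + ((I + J) + unit)) : R :=
  match k with
  | inl (inl i) => b i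
  | inl (inr j) => - c j
  | _ => 0
  end.
have pickv (z : I + J -> R) k : \sum_v - (k == v)%:R * z v = - z k.
  rewrite (bigD1 k) //= eqxx mulN1r big1 ?addr0 // => v /negPf.
  by rewrite eq_sym => ->; rewrite oppr0 mul0r.
have [[z Hz]|[y [yge0 ya yd]]] := farkas a d.
  exists (z \o inr), (z \o inl); split=> /=.
  - by move=> j; have := Hz (inr (inl (inr j))); rewrite /= pickv oppr_le0.
  - move=> i; have := Hz (inl (inl i)); rewrite big_sumType /= big1 ?add0r //.
    by move=> *; rewrite mul0r.
  - by move=> i; have := Hz (inr (inl (inl i))); rewrite /= pickv oppr_le0.
  - move=> j; have := Hz (inl (inr j)); rewrite big_sumType /=.
    rewrite [X in _ + X]big1 ?addr0; last by move=> *; rewrite mul0r.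
    under eq_bigr do rewrite mulNr.
    by rewrite sumrN lerN2.
  - have := Hz (inr (inr tt)); rewrite big_sumType /=.
    under [X in _ + X]eq_bigr do rewrite mulNr.
    by rewrite sumrN subr_le0.
pose u i := y (inl (inl i)); pose v j := y (inl (inr j)).
pose tau := y (inr (inr tt)).
have pick' (w : I + J) : \sum_(k : I + J) y (inr (inl k)) * - (k == w)%:R =
    - y (inr (inl w)).
  rewrite -(pickv (fun k => y (inr (inl k)))); apply: eq_bigr => k _.
  by rewrite mulrC eq_sym.
have unit_sum (F : unit -> R) : \sum_k F k = F tt.
  by rewrite (bigD1 tt) //= big1 ?addr0 // => -[].
have sumK (f : (I + J) + ((I + J) + unit) -> R) : \sum_k f k =
    \sum_i f (inl (inl i)) + \sum_j f (inl (inr j)) +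
    (\sum_w f (inr (inl w)) + f (inr (inr tt))).
  by rewrite big_sumType /=; congr (_ + _); rewrite big_sumType //= unit_sum.
have Hu j : tau * c j <= \sum_i A i j * u i.
  have := ya (inr j); rewrite sumK /= pick'.
  rewrite [X in _ + X + _]big1 ?addr0; last by move=> *; rewrite mulr0.
  have := yge0 (inr (inl (inr j))); rewrite -/tau /u.
  under eq_bigr do rewrite mulrC.
  by move=> H1 H2; lra.
have Hv i : \sum_j A i j * v j <= tau * b i.
  have := ya (inl i); rewrite sumK /= pick'.
  rewrite [X in X + _ + _]big1 ?add0r; last by move=> *; rewrite mulr0.
  have := yge0 (inr (inl (inl i))); rewrite -/tau /v.
  under eq_bigr do rewrite mulrN mulrC.
  by rewrite sumrN => H1 H2; lra.
have uv : \sum_i u i * b i < \sum_j v j * c j.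
  move: yd; rewrite sumK /= mulr0 addr0 [X in _ + _ + X]big1 ?addr0;
    last by move=> *; rewrite mulr0.
  under [X in _ + X]eq_bigr do rewrite mulrN.
  by rewrite sumrN subr_lt0.
have u0 i : 0 <= u i by apply: yge0.
have v0 j : 0 <= v j by apply: yge0.
have exch (f : I -> R) (g : J -> R) :
    \sum_i f i * (\sum_j A i j * g j) = \sum_j g j * (\sum_i A i j * f i).
  under eq_bigr do rewrite mulr_sumr.
  rewrite exchange_big /=; apply: eq_bigr => j _; rewrite mulr_sumr.
  by apply: eq_bigr => i _; ring.
have : 0 <= tau by apply: yge0.
rewrite le_eqVlt => /predU1P[tau0|tau_gt0].
(* Testing [u] against [x0] and [v] against [y0] makes the left side of [uv] nonnegative and the
   right side nonpositive. *)
- have: 0 <= \sum_i u i * b i.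
    apply: (@le_trans _ _ (\sum_i u i * \sum_j A i j * x0 j)).
      rewrite exch; apply: sumr_ge0 => j _; apply: mulr_ge0 => //.
      by apply: le_trans (Hu j); rewrite -tau0 mul0r.
    by apply: ler_sum => i _; apply: ler_wpM2l.
  have: \sum_j v j * c j <= 0.
    apply: (@le_trans _ _ (\sum_j v j * \sum_i A i j * y0 i)).
      by apply: ler_sum => j _; apply: ler_wpM2l.
    rewrite -exch -oppr_ge0 -sumrN; apply: sumr_ge0 => i _.
    rewrite oppr_ge0; apply: mulr_ge0_le0 => //.
    by apply: le_trans (Hv i) _; rewrite -tau0 mul0r.
  by move=> H1 H2; move: (lt_le_trans uv H1); rewrite ltNge H2.
(* Up to the factor [tau], [v] and [u] are feasible, so [uv] contradicts weak duality. *)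
- have : tau * \sum_j v j * c j <= tau * \sum_i u i * b i.
    apply: (@le_trans _ _ (\sum_j v j * \sum_i A i j * u i)).
      rewrite mulr_sumr; apply: ler_sum => j _.
      by rewrite mulrCA; apply: ler_wpM2l.
    rewrite -exch mulr_sumr; apply: ler_sum => i _.
    by rewrite mulrCA; apply: ler_wpM2l.
  by rewrite ler_pM2l // leNgt uv.
Qed.

End Duality.

(** * Tight spans and slimming *)

Section Conjugate.
Variables (R : realType) (S : finType).
Implicit Types (mu : S -> S -> R) (c r : S -> R).

Definition transpose mu : S -> S -> R := fun s t => mu t s.

(** The pointwise least [r] with [mu s t <= c s + r t] for all [s], [t]; [s0] is the default
    required by [arg max]. *)
Definition conjugate mu (s0 : S) c t : R :=
  let F s := mu s t - c s in F [arg max_(s > s0) F s]%O.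

Lemma conjugate_ge mu s0 c s t : mu s t - c s <= conjugate mu s0 c t.
Proof. by rewrite /conjugate; case: arg_maxP => // i _ /(_ s); apply. Qed.

Lemma conjugate_attained mu s0 c t :
  exists s, conjugate mu s0 c t = mu s t - c s.
Proof. by rewrite /conjugate; eexists. Qed.

Lemma conjugate_le mu s0 c t a :
  (forall s, mu s t - c s <= a) -> conjugate mu s0 c t <= a.
Proof. by move=> H; have [s ->] := conjugate_attained mu s0 c t. Qed.

Lemma conjugate_contract mu s0 c1 c2 d :
  (forall s, c2 s - c1 s <= d) ->
  forall t, conjugate mu s0 c1 t - conjugate mu s0 c2 t <= d.
Proof.
move=> H t; have [s ->] := conjugate_attained mu s0 c1 t.
by have := conjugate_ge mu s0 c2 s t; have := H s; lra.
Qed.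

(** The points of Q_mu in terms of equalities: no coordinate can be lowered alone. *)
Definition minimal_pair mu c r : Prop :=
  [/\ forall s t, mu s t <= c s + r t,
      forall s, exists t, c s + r t = mu s t &
      forall t, exists s, c s + r t = mu s t].

Lemma minimal_pair_transpose mu c r :
  minimal_pair mu c r -> minimal_pair (transpose mu) r c.
Proof.
case=> P Ac Ar; split=> [s t|s|t]; rewrite /transpose; first by rewrite addrC.
  by have [u E] := Ar s; exists u; rewrite addrC.
by have [u E] := Ac t; exists u; rewrite addrC.
Qed.

Lemma minimal_pair_conjugate mu s0 c r :
  minimal_pair mu c r -> conjugate mu s0 c = r.
Proof.
case=> P _ A; apply/funext => t; apply/le_anti/andP; split.
  by apply: conjugate_le => s; have := P s t; lra.
by have [s E] := A t; have := conjugate_ge mu s0 c s t; lra.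
Qed.

(** The second conjugate is at most [r], so the equalities that [c'] attains with [r] persist. *)
Lemma minimal_pair_retract mu s0 r :
  let c' := conjugate (transpose mu) s0 r in
  minimal_pair mu c' (conjugate mu s0 c').
Proof.
move=> c'; split=> [s t|s|t].
- by have := conjugate_ge mu s0 c' s t; lra.
- have [t E] := conjugate_attained (transpose mu) s0 r s.
  exists t; apply/le_anti/andP; split; last first.
    by have := conjugate_ge mu s0 c' s t; lra.
  suff : conjugate mu s0 c' t <= r t by move: E; rewrite -/c' /transpose; lra.
  apply: conjugate_le => u.
  by have := conjugate_ge (transpose mu) s0 r t u; rewrite -/c' /transpose; lra.
- by have [s ->] := conjugate_attained mu s0 c' t; exists s; lra.
Qed.

End Conjugate.

(** * Collapsing the fats of one kind *)

Section Raise.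
Variables (R : realType) (S : finType) (mu : S -> S -> R).
Hypothesis mu_ge0 : forall s t, 0 <= mu s t.
Hypothesis mu_diag : forall s, mu s s = 0.
Variable i0 : S * S.
Hypothesis mu_i0 : 0 < mu i0.1 i0.2.
Implicit Types (c r : S -> R).

(* Raise the smallest entries of [c] to a common level: these are the entries of
   tight terminals as long as the level does not exceed [pivot c]. *)
Definition pivot c : R :=
  let F (i : S * S) := Num.max (c i.2) (c i.1 - mu i.1 i.2) in
  F [arg min_(i < i0 | 0 < mu i.1 i.2) F i]%O.

Definition raise c s : R := Num.max (c s) (pivot c).

Lemma pivot_le c t s : 0 < mu t s -> pivot c <= Num.max (c s) (c t - mu t s).
Proof. by move=> H; rewrite /pivot; case: arg_minP => // i _ /(_ (t, s) H). Qed.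

Lemma pivot_attained c : exists t s,
  0 < mu t s /\ pivot c = Num.max (c s) (c t - mu t s).
Proof.
rewrite /pivot; case: arg_minP => // i mui _.
by exists i.1, i.2.
Qed.

Lemma raise_ge c s : c s <= raise c s.
Proof. by rewrite /raise le_max lexx. Qed.

Lemma raise_ge_pivot c s : pivot c <= raise c s.
Proof. by rewrite /raise le_max lexx orbT. Qed.

Lemma raise_low c s : c s < pivot c -> raise c s = pivot c.
Proof. by move=> /ltW /max_idPr. Qed.

Lemma raise_high c s : pivot c <= c s -> raise c s = c s.
Proof. by move=> /max_idPl. Qed.

Lemma pivot_contract c1 c2 d :
  (forall s, c2 s - c1 s <= d) -> pivot c2 - pivot c1 <= d.
Proof.
move=> H; have [t [s [mu_gt0 ->]]] := pivot_attained c1.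
have := pivot_le c2 mu_gt0; have := H s; have := H t.
by rewrite !maxEle; case: ifP; case: ifP; lra.
Qed.

Lemma raise_contract c1 c2 d :
  (forall s, c2 s - c1 s <= d) -> forall s, raise c2 s - raise c1 s <= d.
Proof.
move=> H s; have := pivot_contract H; have := H s.
by rewrite /raise !maxEle; case: ifP; case: ifP; lra.
Qed.

(** If [mu u s > 0], then [pivot_le] and [c s < pivot c] leave [pivot c <= c u - mu u s]; otherwise
    [raise c u] is at least the pivot anyway. Raised entries thus become tight. *)
Lemma conjugate_raise_low s0 c s :
  c s < pivot c -> conjugate mu s0 (raise c) s = - pivot c.
Proof.
move=> cs; apply/le_anti/andP; split; last first.
  by have := conjugate_ge mu s0 (raise c) s s; rewrite mu_diag raise_low //; lra.
apply: conjugate_le => u; have := raise_ge_pivot c u; have := raise_ge c u.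
have := mu_ge0 u s; rewrite le_eqVlt => /predU1P[<-|mu_gt0]; first by lra.
by have := pivot_le c mu_gt0; rewrite le_max leNgt cs /=; lra.
Qed.

Lemma conjugate_raise_le s0 c r t :
  minimal_pair mu c r -> conjugate mu s0 (raise c) t <= r t.
Proof.
by case=> P _ _; apply: conjugate_le => u; have := raise_ge c u; have := P u t; lra.
Qed.

(** A raised entry has equality at its own terminal; the others keep their old equality because the
    r-part only decreases. *)
Lemma minimal_pair_raise s0 c r : minimal_pair mu c r ->
  minimal_pair mu (raise c) (conjugate mu s0 (raise c)).
Proof.
move=> Q; have [P Ac Ar] := Q; split=> [s t|s|t].
- by have := conjugate_ge mu s0 (raise c) s t; lra.
- have [cs|cs] := ltP (c s) (pivot c).
    by exists s; rewrite conjugate_raise_low // raise_low // mu_diag; lra.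
  have [t E] := Ac s; exists t; have := conjugate_ge mu s0 (raise c) s t.
  by have := conjugate_raise_le s0 t Q; rewrite raise_high //; lra.
- by have [s ->] := conjugate_attained mu s0 (raise c) t; exists s; lra.
Qed.

Lemma raise_tight s0 c r s : minimal_pair mu c r -> c s + r s = 0 ->
  raise c s + conjugate mu s0 (raise c) s = 0.
Proof.
move=> Q E; have [cs|cs] := ltP (c s) (pivot c).
  by rewrite conjugate_raise_low // raise_low //; lra.
have := conjugate_raise_le s0 s Q; have := conjugate_ge mu s0 (raise c) s s.
by rewrite raise_high // mu_diag; lra.
Qed.

(** Equivalently, [pivot c] is at most every entry of [c], so that raising [c] again changes
    nothing. *)
Definition low_pair c : Prop := exists t s, 0 < mu t s /\
  forall u, c s <= c u /\ c t - mu t s <= c u.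

Lemma raise_low_pair c : low_pair (raise c).
Proof.
have [t [s [mu_gt0 E]]] := pivot_attained c; exists t, s; split=> // u.
have := raise_ge_pivot c u; move: E; rewrite /raise !maxEle.
by do ![case: ifP]; lra.
Qed.

(** Excludes fats of the first kind as soon as a terminal [x] is tight. Minimality of [c s] gives
    [c s = c x]; the required edge then joins [t] to [s] if [s] is tight, and [s] to [x]
    otherwise. *)
Lemma low_pair_adjacent c r x : minimal_pair mu c r -> low_pair c ->
  c x + r x = 0 ->
  exists y u, [/\ c y + r y = 0, c u + r u <> 0 & c u + r y = mu u y].
Proof.
move=> [P _ _] [t [s [mu_gt0 low]]] tx.
have cs : c s = c x.
  by have := P s x; have := mu_ge0 s x; have := low x; lra.
have [ts|ts] := eqVneq (c s + r s) 0.
- exists s, t; split=> // [tt|].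
    by have := P t s; have := P s t; have := mu_ge0 s t; lra.
  by have := low s; have := P t s; lra.
- exists x, s; split=> //; first exact/eqP.
  by have := P s x; have := mu_ge0 s x; lra.
Qed.

(** Only fats of the first kind are moved by raising: the tight terminals are exactly those where
    [c] is minimal, and a neighbor [u] with [mu u y > 0] would make this minimum at least the
    pivot. *)
Lemma raised_tight_isolated c r s : minimal_pair mu c r -> c s < pivot c ->
  exists2 x, c x + r x = 0 &
  forall y u, c y + r y = 0 -> c u + r y = mu u y -> c u + r u = 0.
Proof.
move=> Q cs; have [P Ac Ar] := Q.
pose x := [arg min_(y < s) c y]%O.
have xmin u : c x <= c u.
  by rewrite /x; case: arg_minP => // i _ /(_ u); apply.
have low y : c y = c x -> c y + r y = 0.
  move=> E; have := P y y; rewrite mu_diag.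
  have [u Eu] := Ar y; have := mu_ge0 u y.
  rewrite le_eqVlt => /predU1P[mu0|mu_gt0]; first by have := xmin u; lra.
  by have := pivot_le c mu_gt0; rewrite le_max E; have := xmin s; lra.
exists x => [|y u ty E]; first exact: low.
have cy : c y = c x.
  by have := P x y; have := mu_ge0 x y; have := xmin y; lra.
apply: low; have := mu_ge0 u y; rewrite le_eqVlt => /predU1P[mu0|mu_gt0].
  by lra.
by have := pivot_le c mu_gt0; rewrite le_max cy; have := xmin s; lra.
Qed.

(** A nontight terminal was not raised, so it keeps an old neighbor [t] with unchanged r-part. If
    [t] were tight, its r-part would be at most [- pivot c], but the inequality for [s1] and [t]
    makes it larger. *)
Lemma raised_untight_adjacent s0 c r s1 s : minimal_pair mu c r ->
  c s1 < pivot c -> let h := conjugate mu s0 (raise c) in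
  raise c s + h s <> 0 ->
  exists2 u, raise c u + h u <> 0 & raise c s + h u = mu s u.
Proof.
move=> Q cs1 h nts; have [P Ac Ar] := Q.
have cs : pivot c <= c s.
  rewrite leNgt; apply/negP => cs; apply: nts.
  by rewrite /h conjugate_raise_low // raise_low //; lra.
have [t E] := Ac s; have ht : h t = r t.
  have := conjugate_ge mu s0 (raise c) s t; rewrite -/h raise_high //.
  by have := conjugate_raise_le s0 t Q; rewrite -/h; lra.
exists t; last by rewrite ht raise_high.
move=> tt; have := P s1 t; have := mu_ge0 s1 t; rewrite -ht.
by have := raise_ge_pivot c t; lra.
Qed.

End Raise.

(** * The asymmetric distance of points *)

Section PointDistance.
Variables (R : realType) (S : finType).
Implicit Types (p q : crpoint R S).

(* The least such [d] is [Dinf p q] without the positive parts; unlike [Dinf], it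
   changes by [b - a] when [p] and [q] move by [a] and [b] along the line L. *)
Definition dist_le p q (d : R) : Prop :=
  (forall s, q (inl s) - p (inl s) <= d) /\ (forall s, p (inr s) - q (inr s) <= d).

Lemma Dplus_le (f g : S -> R) d :
  (Dplus f g <= d) <-> 0 <= d /\ forall s, g s - f s <= d.
Proof.
split=> [/bigmax_leP[d0 H]|[d0 H]].
  by split=> // s; have := H s isT; rewrite ge_max => /andP[].
by apply/bigmax_leP; split=> // s _; rewrite ge_max H.
Qed.

Lemma Dinf_le p q d : (Dinf p q <= d) <-> 0 <= d /\ dist_le p q d.
Proof.
rewrite /Dinf ge_max; split=> [/andP[/Dplus_le[d0 Hc] /Dplus_le[_ Hr]]|].
  by [].
by case=> d0 [Hc Hr]; apply/andP; split; apply/Dplus_le.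
Qed.

Lemma dist_le_Dinf p q : dist_le p q (Dinf p q).
Proof. by have [_] := (Dinf_le p q (Dinf p q)).1 (lexx _). Qed.

Lemma Dinf_ge0 p q : 0 <= Dinf p q.
Proof. by have [] := (Dinf_le p q (Dinf p q)).1 (lexx _). Qed.

End PointDistance.

(** * Fats, slim points and slimmed sections *)

Section TightSpan.
Variables (R : realType) (S : finType) (mu : S -> S -> R).
Hypothesis hmu : directed_distance mu.
Implicit Types (p q : crpoint R S) (X : {set S}) (s t : S).

Let mu_ge0 : forall s t, 0 <= mu s t := hmu.1.
Let mu_diag : forall s, mu s s = 0 := hmu.2.

Definition cpart p s := p (inl s).
Definition rpart p s := p (inr s).
Definition join_point (c r : S -> R) : crpoint R S :=
  [ffun x => match x with inl s => c s | inr s => r s end].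

Lemma join_pointE p : join_point (cpart p) (rpart p) = p.
Proof. by apply/ffunP => -[] s; rewrite ffunE. Qed.

Lemma cpart_join c r : cpart (join_point c r) = c.
Proof. by apply/funext => s; rewrite /cpart ffunE. Qed.

Lemma rpart_join c r : rpart (join_point c r) = r.
Proof. by apply/funext => s; rewrite /rpart ffunE. Qed.

(** Lowering one coordinate to its conjugate value stays in P_mu, so minimality forbids any change;
    the conjugate value attains an equality. *)
Lemma Q_minimal_pair p : Q_ mu p <-> minimal_pair mu (cpart p) (rpart p).
Proof.
split=> [[P min]|[P Ac Ar]]; last first.
  split=> // q Pq qp; apply/ffunP => -[] s; apply/le_anti; rewrite qp /=.
    by have [t] := Ac s; have := qp (inr t); have := Pq s t; rewrite /cpart /rpart; lra.
  by have [t] := Ar s; have := qp (inl t); have := Pq t s; rewrite /cpart /rpart; lra.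
split=> // [s|t].
- pose a := conjugate (transpose mu) s (rpart p) s.
  pose q := join_point (fun u => if u == s then a else cpart p u) (rpart p).
  have aE u : mu s u - rpart p u <= a.
    exact: (conjugate_ge (transpose mu) s (rpart p) u s).
  have [t at_] := conjugate_attained (transpose mu) s (rpart p) s.
  have Pq : P_ mu q.
    move=> u v; rewrite !ffunE; case: eqP => [->|_]; last exact: P.
    by have := aE v; lra.
  have <- : q = p.
    apply: min Pq _ => -[] u; rewrite ffunE //; case: eqP => [->|//].
    by have := P s t; move: at_; rewrite -/a /transpose /rpart; lra.
  exists t; rewrite /cpart /rpart !ffunE eqxx.
  by move: at_; rewrite -/a /transpose /rpart; lra.
- pose a := conjugate mu t (cpart p) t.
  pose q := join_point (cpart p) (fun u => if u == t then a else rpart p u).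
  have aE u : mu u t - cpart p u <= a.
    exact: (conjugate_ge mu t (cpart p) u t).
  have [s as_] := conjugate_attained mu t (cpart p) t.
  have Pq : P_ mu q.
    move=> u v; rewrite !ffunE; case: eqP => [->|_]; last exact: P.
    by have := aE u; lra.
  have <- : q = p.
    apply: min Pq _ => -[] u; rewrite ffunE //; case: eqP => [->|//].
    by have := P s t; move: as_; rewrite -/a /cpart; lra.
  exists s; rewrite /cpart /rpart !ffunE eqxx.
  by move: as_; rewrite -/a /cpart; lra.
Qed.

Definition tight p s : bool := p (inl s) + p (inr s) == 0.
Definition tight_set p : {set S} := [set s | tight p s].

Lemma QX_tight_set X p : QX mu X p <-> Q_ mu p /\ X = tight_set p.
Proof.
split=> [[Qp H]|[Qp ->]]; split=> //.
  by apply/setP => s; rewrite inE /tight -(mu_diag s); apply/idP/idP => /H.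
by move=> s; rewrite inE /tight /= mu_diag.
Qed.

Lemma P_point p s t : Q_ mu p -> mu s t <= p (inl s) + p (inr t).
Proof. by case. Qed.

(** The two cross sums are nonnegative and add up to zero. *)
Lemma tight_mu p s t : Q_ mu p -> tight p s -> tight p t ->
  p (inl s) + p (inr t) = 0 /\ mu s t = 0.
Proof.
move=> Qp /eqP ts /eqP tt; have := P_point s t Qp; have := P_point t s Qp.
by have := mu_ge0 s t; have := mu_ge0 t s; lra.
Qed.

Lemma S0_tight_set p : Q_ mu p -> S0 mu (tight_set p).
Proof. by move=> Qp s t; rewrite !inE => ts tt; have [] := tight_mu Qp ts tt. Qed.

Lemma neighbors_copyc p X : neighbors mu p (copyc X) =
  copyr (finset (fun t => [exists s in X, p (inl s) + p (inr t) == mu s t])).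
Proof.
apply/setP => -[s|t]; rewrite inE.
  rewrite [in RHS]/copyr; apply/andP/imsetP => [[_ /exists_inP[y]]|[]//].
  by case/imsetP => u _ ->.
rewrite mem_imset ?inE; last by move=> ? ? [].
have -> /= : inr t \notin copyc X by apply/imsetP => -[].
apply/exists_inP/exists_inP => [[y /imsetP[s sX ->]]|[s sX]] /= E.
  by exists s.
by exists (inl s); first exact: imset_f.
Qed.

Lemma neighbors_copyr p X : neighbors mu p (copyr X) =
  copyc (finset (fun s => [exists t in X, p (inl s) + p (inr t) == mu s t])).
Proof.
apply/setP => -[s|t]; rewrite inE; last first.
  rewrite [in RHS]/copyc; apply/andP/imsetP => [[_ /exists_inP[y]]|[]//].
  by case/imsetP => u _ ->.
rewrite mem_imset ?inE; last by move=> ? ? [].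
have -> /= : inl s \notin copyr X by apply/imsetP => -[].
apply/exists_inP/exists_inP => [[y /imsetP[t tX ->]]|[t tX]] /= E.
  by exists t.
by exists (inr t); first exact: imset_f.
Qed.

Lemma copyc_inj : injective (@copyc S).
Proof. by apply: imset_inj => ? ? []. Qed.

Lemma copyr_inj : injective (@copyr S).
Proof. by apply: imset_inj => ? ? []. Qed.

(* [K(p)] has no edge between [(S \ X)^c] and [X^r], respectively between
   [X^c] and [(S \ X)^r], where [X] is the set of tight terminals. *)
Definition fat_c p := forall s t,
  p (inl s) + p (inr t) = mu s t -> tight p t -> tight p s.
Definition fat_r p := forall s t,
  p (inl s) + p (inr t) = mu s t -> tight p s -> tight p t.

(** The reverse inclusions, which turn a fat of the respective kind into a degenerate point. *)
Definition covered_c p := forall t, ~~ tight p t ->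
  exists2 s, ~~ tight p s & p (inl s) + p (inr t) = mu s t.
Definition covered_r p := forall s, ~~ tight p s ->
  exists2 t, ~~ tight p t & p (inl s) + p (inr t) = mu s t.

Lemma fat_tight_set p X : Q_ mu p ->
  fat mu X p <-> X = tight_set p /\ (fat_c p \/ fat_r p).
Proof.
move=> Qp.
have inj_r : injective (@inr S S) by move=> ? ? [].
have inj_l : injective (@inl S S) by move=> ? ? [].
have fc : neighbors mu p (copyc (~: tight_set p)) \subset copyr (~: tight_set p)
    <-> fat_c p.
  rewrite neighbors_copyc; split=> [/fintype.subsetP sub s t E tt|H].
    apply/negPn/negP => ns; have : inr t \in copyr (~: tight_set p).
      apply/sub/imset_f; rewrite inE; apply/exists_inP; exists s; rewrite ?inE //.
      exact/eqP.
    by rewrite mem_imset // !inE tt.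
  apply/imsetS/fintype.subsetP => t; rewrite !inE => /exists_inP[s]; rewrite !inE => ns /eqP E.
  by apply: contra ns => /(H _ _ E).
have fr : neighbors mu p (copyr (~: tight_set p)) \subset copyc (~: tight_set p)
    <-> fat_r p.
  rewrite neighbors_copyr; split=> [/fintype.subsetP sub s t E ts|H].
    apply/negPn/negP => nt; have : inl s \in copyc (~: tight_set p).
      apply/sub/imset_f; rewrite inE; apply/exists_inP; exists t; rewrite ?inE //.
      exact/eqP.
    by rewrite mem_imset // !inE ts.
  apply/imsetS/fintype.subsetP => s; rewrite !inE => /exists_inP[t]; rewrite !inE => nt /eqP E.
  by apply: contra nt => /(H _ _ E).
split=> [[/QX_tight_set[_ ->] [/fc|/fr]]|[-> H]]; [by split; auto..|].
split; first exact/QX_tight_set.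
by case: H => [/fc|/fr]; auto.
Qed.

Lemma Qdeg_tight_set p X : Q_ mu p -> Qdeg mu X p <->
  X = tight_set p /\ (fat_c p /\ covered_c p \/ fat_r p /\ covered_r p).
Proof.
move=> Qp.
have fc : neighbors mu p (copyc (~: tight_set p)) = copyr (~: tight_set p)
    <-> fat_c p /\ covered_c p.
  rewrite neighbors_copyc; split=> [/copyr_inj/setP E|[F C]].
    split=> [s t st tt|t nt].
      apply/negPn/negP => ns; have := E t; rewrite !inE tt => /exists_inP[].
      by exists s; rewrite ?inE //; apply/eqP.
    have := E t; rewrite !inE nt => /exists_inP[s]; rewrite !inE => ns /eqP.
    by exists s.
  congr copyr; apply/setP => t; rewrite !inE.
  apply/exists_inP/idP => [[s]|/C[s ns /eqP st]]; last by exists s; rewrite ?inE.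
  by rewrite !inE => ns /eqP st; apply: contra ns; apply: F.
have fr : neighbors mu p (copyr (~: tight_set p)) = copyc (~: tight_set p)
    <-> fat_r p /\ covered_r p.
  rewrite neighbors_copyr; split=> [/copyc_inj/setP E|[F C]].
    split=> [s t st ts|s ns].
      apply/negPn/negP => nt; have := E s; rewrite !inE ts => /exists_inP[].
      by exists t; rewrite ?inE //; apply/eqP.
    have := E s; rewrite !inE ns => /exists_inP[t]; rewrite !inE => nt /eqP.
    by exists t.
  congr copyc; apply/setP => s; rewrite !inE.
  apply/exists_inP/idP => [[t]|/C[t nt /eqP st]]; last by exists t; rewrite ?inE.
  by rewrite !inE => nt /eqP st; apply: contra nt; apply: F.
split=> [[/QX_tight_set[_ ->] [/fc|/fr]]|[-> H]]; [by split; auto..|].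
split; first exact/QX_tight_set.
by case: H => [/fc|/fr]; auto.
Qed.

Lemma Qslim_degenerate p : Qslim mu p <->
  Q_ mu p /\ (fat_c p \/ fat_r p -> Qdeg mu (tight_set p) p).
Proof.
split=> [[Qp nfat]|[Qp H]]; split=> //.
  move=> F; apply: contrapT => ndeg; apply: nfat; split.
    by exists (tight_set p); split; [exact: S0_tight_set|exact/fat_tight_set].
  by case=> X [_ degX]; move: (degX) => /(Qdeg_tight_set _ Qp)[E _]; rewrite -E in ndeg.
case=> -[X [_ /(fat_tight_set _ Qp)[_ /H deg]]]; apply.
by exists (tight_set p); split => //; exact: S0_tight_set.
Qed.

(* For [p] in [Q_mu] this says that [p] is not a fat of the second kind, unless
   no or every terminal is tight. *)
Definition escapes_r p := forall x y, tight p x -> ~~ tight p y ->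
  exists s t, [/\ tight p s, ~~ tight p t & p (inl s) + p (inr t) = mu s t].

(** [escapes_r] rules out fats of the second kind, the last hypothesis makes those of the first
    degenerate. With no or every terminal tight, the point is degenerate anyway. *)
Lemma Qslim_escapes_r p : Q_ mu p -> escapes_r p ->
  (forall x y, fat_c p -> tight p x -> ~~ tight p y -> covered_c p) ->
  Qslim mu p.
Proof.
move=> Qp er H; apply/Qslim_degenerate; split=> // F; apply/Qdeg_tight_set => //.
split=> //; have [/existsP[x tx]|/existsPn nt] := boolP [exists x, tight p x]; last first.
  have ntE t : tight p t = false by apply/negbTE/nt.
  left; split=> [s t _|t _]; first by rewrite ntE.
  have [_ _ /(_ t)[s st]] := (Q_minimal_pair p).1 Qp.
  by exists s; first exact: nt.
have [/existsP[y ny]|/existsPn at_] := boolP [exists y, ~~ tight p y].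
  case: F => F; first by left; split=> //; exact: (H x y).
  have [s [t [ts /negP nt st]]] := er x y tx ny.
  by case: nt; apply: F ts.
left; split=> [s t _ _|t nt]; first by move: (at_ s); rewrite negbK.
by move: (at_ t); rewrite nt.
Qed.

Lemma tight_mu0 p : Q_ mu p -> (forall s t, mu s t = 0) -> forall s, tight p s.
Proof.
move=> /Q_minimal_pair[P Ac Ar] mu0 s; rewrite /tight.
have [t Et] := Ac s; have [u Eu] := Ar s.
have := P u t; have := P s s; move: Et Eu; rewrite !mu0 /cpart /rpart => *.
by apply/eqP; lra.
Qed.

(** [F] raises the c-part, conjugates, raises the r-part and conjugates back. The raising of the
    r-part comes last, so [escapes_r] always holds; for fats of the first kind it matters whether
    this raising moves anything. *)
Lemma slimming : exists F : crpoint R S -> crpoint R S,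
  (forall p, Q_ mu p ->
    [/\ Qslim mu (F p), escapes_r (F p), forall s, tight p s -> tight (F p) s &
        ~ fat_c p -> ~ fat_r p -> F p = p]) /\
  (forall p q d, dist_le p q d -> dist_le (F p) (F q) d).
Proof.
have [/existsP[i0 mu_i0]|/existsPn mu0] :=
  boolP [exists i : S * S, 0 < mu i.1 i.2]; last first.
  (* Without a positive distance there is no pivot, but all terminals are tight at every point of
     Q_mu. *)
  exists id; split=> // p Qp.
  have muE s t : mu s t = 0.
    by apply/le_anti; rewrite mu_ge0 leNgt (mu0 (s, t)).
  have T := tight_mu0 Qp muE.
  have er : escapes_r p by move=> x y _; rewrite T.
  by split=> //; apply: Qslim_escapes_r => // x y _ _; rewrite T.
pose mut := transpose mu; pose j0 := (i0.2, i0.1).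
have mut_ge0 s t : 0 <= mut s t by apply: mu_ge0.
have mut_diag s : mut s s = 0 by apply: mu_diag.
have mut_j0 : 0 < mut j0.1 j0.2 by [].
pose c1 p := raise mu i0 (cpart p); pose r1 p := conjugate mu i0.1 (c1 p).
pose r2 p := raise mut j0 (r1 p); pose c2 p := conjugate mut i0.1 (r2 p).
pose F p := join_point (c2 p) (r2 p).
have lowF p s : F p (inl s) = c2 p s by rewrite ffunE.
have uppF p s : F p (inr s) = r2 p s by rewrite ffunE.
exists F; split; last first.
  move=> p q d [Hc Hr].
  have H1 := raise_contract mu_i0 Hc.
  have H2 := conjugate_contract mu i0.1 H1.
  have H3 := raise_contract mut_j0 H2.
  have H4 := conjugate_contract mut i0.1 H3.
  by split=> s; rewrite ?lowF ?uppF; [exact: H4|exact: H3].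
move=> p Qp; have M := (Q_minimal_pair p).1 Qp.
have M1 : minimal_pair mu (c1 p) (r1 p).
  exact: (minimal_pair_raise mu_ge0 mu_diag mu_i0 _ M).
have M1t : minimal_pair mut (r1 p) (c1 p) by apply: minimal_pair_transpose.
have M2t : minimal_pair mut (r2 p) (c2 p).
  exact: (minimal_pair_raise mut_ge0 mut_diag mut_j0 _ M1t).
have QF : Q_ mu (F p).
  apply/Q_minimal_pair; rewrite cpart_join rpart_join.
  exact: minimal_pair_transpose M2t.
have tF s : tight (F p) s = (r2 p s + c2 p s == 0).
  by rewrite /tight lowF uppF addrC.
have er : escapes_r (F p).
  move=> x y; rewrite tF => /eqP tx _.
  have [s [t [ts nt st]]] :=
    low_pair_adjacent mut_ge0 M2t (raise_low_pair mut_j0 (r1 p)) tx.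
  exists s, t; rewrite !tF lowF uppF; split; [exact/eqP|exact/eqP|].
  by rewrite addrC st.
split=> //.
- apply: Qslim_escapes_r => // x y Fc tx ny.
  have [/existsP[s1 Hs1]|/existsPn nomove] :=
    boolP [exists s, r1 p s < pivot mut j0 (r1 p)].
    (* A nontrivial second raising makes fats of the first kind degenerate. *)
    move=> t; rewrite tF => /eqP nt.
    have [s ns st] := raised_untight_adjacent mut_ge0 mut_diag mut_j0 M1t Hs1 nt.
    by exists s; rewrite ?tF ?lowF ?uppF; [exact/eqP|rewrite addrC st].
  (* A trivial second raising leaves the result of the first, whose low pair excludes fats of the
     first kind. *)
  have r2E : r2 p = r1 p.
    by apply/funext => s; rewrite /r2 raise_high // leNgt nomove.
  have c2E : c2 p = c1 p by rewrite /c2 r2E (minimal_pair_conjugate _ M1t).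
  have tx1 : c1 p x + r1 p x = 0 by move: tx; rewrite tF r2E c2E addrC => /eqP.
  have [s [u [ts nu su]]] :=
    low_pair_adjacent mu_ge0 M1 (raise_low_pair mu_i0 (cpart p)) tx1.
  have := Fc u s; rewrite !tF lowF uppF r2E c2E su => /(_ erefl).
  by rewrite addrC ts eqxx => /(_ isT) /eqP; rewrite addrC.
- move=> s /eqP ts; rewrite tF.
  have ts1 := raise_tight mu_ge0 mu_diag mu_i0 i0.1 M ts.
  rewrite addrC in ts1.
  by have /eqP := raise_tight mut_ge0 mut_diag mut_j0 i0.1 M1t ts1.
(* A raising that moves a point needs a fat of its kind, so both fix [p]. *)
- move=> nc nr.
  have c1E : c1 p = cpart p.
    apply/funext => s; rewrite /c1 raise_high // leNgt; apply/negP.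
    move=> /(raised_tight_isolated mu_ge0 mu_diag mu_i0 M)[x _ iso].
    by apply: nc => u y uy /eqP ty; apply/eqP; apply: iso ty uy.
  have r1E : r1 p = rpart p by rewrite /r1 c1E (minimal_pair_conjugate _ M).
  rewrite c1E r1E in M1t.
  have r2E : r2 p = rpart p.
    rewrite /r2 r1E; apply/funext => s; rewrite raise_high // leNgt; apply/negP.
    move=> /(raised_tight_isolated mut_ge0 mut_diag mut_j0 M1t)[x _ iso].
    apply: nr => y u yu /eqP ty; apply/eqP; rewrite addrC; apply: (iso y).
      by rewrite addrC.
    by rewrite addrC.
  have c2E : c2 p = cpart p by rewrite /c2 r2E (minimal_pair_conjugate _ M1t).
  by rewrite /F c2E r2E join_pointE.
Qed.

(** An edge of K(p) from a tight to a nontight terminal forces [b >= 0], since [q] must satisfy its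
    inequality. If no or every terminal is tight, the shift on [X] vanishes or is absorbed into
    [a]. *)
Lemma slim_representative p q : escapes_r p -> slim_equiv mu q p ->
  exists a b X, [/\ 0 <= b,
    b = 0 \/ [/\ X = tight_set q, Qdeg mu X p & Qdeg mu X q],
    forall s, q (inl s) = p (inl s) + a + b * (s \in X)%:R &
    forall s, q (inr s) = p (inr s) - a - b * (s \in X)%:R].
Proof.
move=> er [[a E]|[X [_ dq dp [b [a E]]]]].
  exists a, 0, finset.set0; split=> [//||s|s]; first by left.
    have := congr1 (fun f : crpoint R S => f (inl s)) E.
    by rewrite !ffunE !inE /= => ?; lra.
  have := congr1 (fun f : crpoint R S => f (inr s)) E.
  by rewrite !ffunE !inE /= => ?; lra.
have Ec s : q (inl s) = p (inl s) + a + b * (s \in X)%:R.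
  have := congr1 (fun f : crpoint R S => f (inl s)) E.
  by rewrite !ffunE !inE /= => ?; lra.
have Er s : q (inr s) = p (inr s) - a - b * (s \in X)%:R.
  have := congr1 (fun f : crpoint R S => f (inr s)) E.
  by rewrite !ffunE !inE /= => ?; lra.
have Qp : Q_ mu p by case: dp => -[].
have Qq : Q_ mu q by case: dq => -[].
have /(Qdeg_tight_set _ Qp)[XE _] := dp; have /(Qdeg_tight_set _ Qq)[XE' _] := dq.
have inX s : (s \in X) = tight p s by rewrite XE inE.
have [/existsP[x tx]|/existsPn nt] := boolP [exists x, tight p x]; last first.
  exists a, 0, X; split=> [//||s|s]; first by left.
    by rewrite Ec inX (negbTE (nt s)) mulr0 mul0r.
  by rewrite Er inX (negbTE (nt s)) mulr0 mul0r.
have [/existsP[y ny]|/existsPn at_] := boolP [exists y, ~~ tight p y]; last first.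
  have tp s : tight p s by move: (at_ s); rewrite negbK.
  exists (a + b), 0, X; split=> [//||s|s]; first by left.
    by rewrite Ec inX tp mul0r mulr1 addr0 addrA.
  by rewrite Er inX tp mul0r mulr1 subr0 opprD addrA.
have [s [t [ts nt st]]] := er x y tx ny.
exists a, b, X; split=> //; last by right.
by have := P_point s t Qq; rewrite Ec Er !inX ts (negbTE nt) /=; lra.
Qed.

(* If the largest term [q(s^c) - p(s^c)] exceeded [d], it would sit at a tight
   terminal of [q], and nonnegativity would make [p] vanish on [X^r]. Then [X^r]
   is adjacent in [K(p)] to tight nodes only, so that [p] is a fat, and being slim
   it is degenerate relative to the same [X] as [q]: this contradicts the last
   condition on slimmed sections. *)
Lemma slimmed_section_dist (A : set (crpoint R S)) p q b X d :
  slimmed_section_nonneg mu A -> A p -> A q -> 0 <= b ->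
  b = 0 \/ X = tight_set q /\ Qdeg mu X q ->
  (forall s, q (inl s) - b * (s \in X)%:R - p (inl s) <= d) -> Dinf p q <= d.
Proof.
move=> [bal Apos _ sec] Ap Aq b0 degq Hd.
have [slp p0] := Apos _ Ap; have [[Qq _] q0] := Apos _ Aq.
have [Qp degp] := (Qslim_degenerate p).1 slp.
(* Balancedness yields a nonnegative c-difference, so the largest one also bounds the positive parts
   in [Dinf]. *)
have [s1 Hs1] : exists s, p (inl s) <= q (inl s).
  apply: contrapT => H.
  have [] := bal _ _ Aq Ap; move=> Hc _; case: Hc => s; rewrite ltNge.
  by apply/negP => Hs; apply: H; exists s.
pose f s := q (inl s) - p (inl s).
pose s0 := [arg max_(s > s1) f s]%O; pose m := f s0.
have fm s : f s <= m.
  by rewrite /m /s0; case: arg_maxP => // i _ /(_ s); apply.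
have m0 : 0 <= m by apply: le_trans (fm s1); rewrite /f subr_ge0.
(* An equality of [p] at t^r bounds this r-difference by a c-difference. *)
have rm t : p (inr t) - q (inr t) <= m.
  have [_ _ /(_ t)[s]] := (Q_minimal_pair p).1 Qp.
  by have := fm s; have := P_point s t Qq; rewrite /f /cpart /rpart; lra.
suff md : m <= d.
  apply/Dinf_le; split; first exact: le_trans md.
  by split=> s; apply: le_trans md; [exact: fm|exact: rm].
rewrite leNgt; apply/negP => dm.
have big_in s : d < f s -> s \in X /\ b != 0.
  move=> ds; have := Hd s; move: ds; rewrite /f; case: (s \in X).
    move=> H1 H2; split=> //; apply: contraTneq H1 => b00.
    by rewrite -leNgt; move: H2; rewrite b00 mul0r subr0.
  by rewrite mulr0 subr0 => H1 H2; have := lt_le_trans H1 H2; rewrite ltxx.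
have [s0X bn0] := big_in _ dm.
case: degq => [b00|[XE degq]]; first by rewrite b00 eqxx in bn0.
have zero_at (r : crpoint R S) s : (forall x, 0 <= r x) -> tight r s ->
    r (inl s) = 0 /\ r (inr s) = 0.
  by move=> r0 /eqP; have := r0 (inl s); have := r0 (inr s); lra.
have qX s : s \in X -> q (inl s) = 0 /\ q (inr s) = 0.
  by rewrite XE inE; apply: zero_at.
have [mE d0] : m = 0 /\ d < 0.
  have : m <= 0 by rewrite /m /f (qX _ s0X).1; have := p0 (inl s0); lra.
  by move=> ?; lra.
have pr0 t : t \in X -> p (inr t) = 0.
  by move=> tX; have := rm t; rewrite mE (qX _ tX).2; have := p0 (inr t); lra.
(* At a neighbor [s] of X^r the inequality for [q] gives [f s >= 0 > d], which puts [s] into [X]. *)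
have nbrX s t : t \in X -> p (inl s) + p (inr t) = mu s t -> s \in X /\ tight p s.
  move=> tX st; have := P_point s t Qq; rewrite (qX _ tX).2 => Pq.
  have [|sX _] := big_in s; first by rewrite /f; move: st; rewrite pr0 //; lra.
  split=> //; rewrite /tight (pr0 _ sX).
  have := fm s; rewrite mE /f (qX _ sX).1; move: st; rewrite (pr0 _ tX) => st.
  have := mu_ge0 s t; move: Pq; rewrite (qX _ sX).1 => *; apply/eqP; lra.
have [_ _ /(_ s0)[u us0]] := (Q_minimal_pair p).1 Qp.
have [uX tu] := nbrX _ _ s0X us0.
have tight_X x : tight p x -> x \in X.
  move=> tx; have [] := nbrX x u uX; last by [].
  by have [-> ->] := tight_mu Qp tx tu.
have Fc : fat_c p by move=> s t st /tight_X tX; have [] := nbrX _ _ tX st.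
have degp' : Qdeg mu (tight_set p) p by apply: degp; left.
have X_tight t : t \in X -> tight p t.
  move=> tX; have /(Qdeg_tight_set _ Qp)[_ [[_ cov]|[Fr _]]] := degp'.
    apply/negPn/negP => /cov[s ns st].
    by have [_ ts] := nbrX _ _ tX st; rewrite ts in ns.
  have [_ _ /(_ t)[s st]] := (Q_minimal_pair p).1 Qp.
  by have [_ ts] := nbrX _ _ tX st; apply: Fr ts.
have XpE : tight_set p = X.
  by apply/setP => s; rewrite inE; apply/idP/idP; [exact: tight_X|exact: X_tight].
rewrite XpE in degp'.
(* Outside [X] every c-difference is at most [d < 0], so [q] lies strictly below [p] there. *)
have [] := sec X _ q p.
- by rewrite XE; apply: S0_tight_set.
- by split=> //; split.
- by split=> //; split.
move=> + _; apply=> s nsX; rewrite ltNge; apply/negP => Hs.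
have [|] := big_in s; first by rewrite /f; lra.
by rewrite (negbTE nsX).
Qed.

End TightSpan.

(** * Lengths, flows and locations *)

Section Walks.
Variables (R : realType) (V : finType) (E : rel V) (l : V * V -> R).
Hypothesis l_ge0 : forall e, 0 <= l e.
Implicit Types (x y z : V) (w : seq V).

Definition walk_length x w : R := \sum_(e <- zip (x :: w) w) l e.

Lemma walk_length_cons x y w :
  walk_length x (y :: w) = l (x, y) + walk_length y w.
Proof. by rewrite /walk_length /= big_cons. Qed.

Lemma walk_length_ge0 x w : 0 <= walk_length x w.
Proof. exact: sumr_ge0. Qed.

Lemma walk_length_cat x w1 w2 :
  walk_length x (w1 ++ w2) = walk_length x w1 + walk_length (last x w1) w2.
Proof.
elim: w1 x => [|y w1 IH] x /=; first by rewrite /walk_length big_nil add0r.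
by rewrite !walk_length_cons IH addrA.
Qed.

Lemma simple_walk x w : path E x w -> exists w',
  [/\ path E x w', last x w' = last x w, uniq (x :: w') &
      walk_length x w' <= walk_length x w].
Proof.
elim: w x => [|y w IH] x /=; first by exists [::].
case/andP=> xy /IH[w' [pw' lw' uw' lenw']].
have [xw|xw] := boolP (x \in y :: w'); last first.
  exists (y :: w'); split; rewrite ?walk_length_cons ?lerD2l //.
    by rewrite /= xy.
  by rewrite cons_uniq xw.
case/splitPl: xw pw' lw' uw' lenw' => w1 w2 lw1.
rewrite cat_path last_cat lw1 -cat_cons cat_uniq => /andP[_ pw2] lw2.
case/and3P=> _ dis uw2; rewrite walk_length_cat lw1 walk_length_cons => len.
exists w2; split=> //.
  rewrite /= uw2 andbT; apply: contra dis => xw2.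
  by apply/hasP; exists x => //; rewrite -lw1 mem_last.
by have := l_ge0 (x, y); have := walk_length_ge0 y w1; lra.
Qed.

Variable M : R.
Hypothesis M_ge0 : 0 <= M.

Definition walk_lengths x y : set R :=
  [set v | v = M \/ exists w, [/\ path E x w, last x w = y & v = walk_length x w]].

(* The distance truncated at [M], so that it is finite on unreachable pairs. *)
Definition trunc_dist x y : R := inf (walk_lengths x y).

Lemma trunc_dist_ge x y a : a <= M ->
  (forall w, path E x w -> last x w = y -> a <= walk_length x w) ->
  a <= trunc_dist x y.
Proof.
move=> aM H; apply: lb_le_inf; first by exists M; left.
by move=> v [->//|[w [pw lw ->]]]; apply: H.
Qed.

Lemma walk_lengths_lb x y : has_lbound (walk_lengths x y).
Proof. by exists 0 => v [->//|[w [_ _ ->]]]; apply: walk_length_ge0. Qed.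

Lemma trunc_dist_walk x w : path E x w -> trunc_dist x (last x w) <= walk_length x w.
Proof. by move=> pw; apply: (ge_inf (walk_lengths_lb _ _)); right; exists w. Qed.

Lemma trunc_dist_le x y : trunc_dist x y <= M.
Proof. by apply: (ge_inf (walk_lengths_lb _ _)); left. Qed.

Lemma trunc_dist_ge0 x y : 0 <= trunc_dist x y.
Proof. by apply: trunc_dist_ge => // w _ _; apply: walk_length_ge0. Qed.

Lemma trunc_dist_refl x : trunc_dist x x = 0.
Proof.
apply/le_anti; rewrite trunc_dist_ge0 andbT.
have := @trunc_dist_walk x [::] isT.
by rewrite /walk_length /= big_nil.
Qed.

Lemma trunc_dist_edgel x y z :
  E x y -> trunc_dist x z - trunc_dist y z <= l (x, y).
Proof.
move=> xy; rewrite lerBlDl -lerBlDr; apply: trunc_dist_ge.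
  by have := trunc_dist_le x z; have := l_ge0 (x, y); lra.
move=> w pw <-; have := @trunc_dist_walk x (y :: w).
by rewrite /= xy pw walk_length_cons => /(_ isT); lra.
Qed.

Lemma trunc_dist_edger x y z :
  E y z -> trunc_dist x z - trunc_dist x y <= l (y, z).
Proof.
move=> yz; rewrite lerBlDl -lerBlDr; apply: trunc_dist_ge.
  by have := trunc_dist_le x z; have := l_ge0 (y, z); lra.
move=> w pw lw; have := @trunc_dist_walk x (rcons w z).
rewrite rcons_path pw lw yz last_rcons -cats1 walk_length_cat lw => /(_ isT).
by rewrite walk_length_cons /walk_length /= big_nil; lra.
Qed.

(** The hypothesis concerns simple walks only, as terminal paths are simple; nonnegative lengths
    allow the concatenation through [y] to be shortened to one. *)
Lemma trunc_dist_cover x y z m : m <= M ->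
  (forall w, path E x w -> last x w = z -> uniq (x :: w) -> m <= walk_length x w) ->
  m <= trunc_dist x y + trunc_dist y z.
Proof.
move=> mM H; rewrite -lerBlDr; apply: trunc_dist_ge => [|w1 pw1 lw1].
  by have := trunc_dist_ge0 y z; lra.
rewrite lerBlDr -lerBlDl; apply: trunc_dist_ge => [|w2 pw2 lw2].
  by have := walk_length_ge0 x w1; lra.
rewrite lerBlDl -lw1 -walk_length_cat.
have [|w [pw lw uw lenw]] := @simple_walk x (w1 ++ w2).
  by rewrite cat_path pw1 lw1.
by apply: le_trans lenw; apply: H; rewrite // lw last_cat lw1.
Qed.

End Walks.

(** * Multiflows as a linear program *)

Section MaxFlow.
Variables (R : realType) (S : finType) (mu : S -> S -> R) (N : network S).
Hypothesis mu_ge0 : forall s t, 0 <= mu s t.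
Local Notation npath := (S * S * seq (node N))%type.

Lemma path_edges_uniq (P : npath) : terminal_path P -> uniq (path_edges P).
Proof. by case: P => [[s t] w] /and4P[_ _ _ /= /andP[_ uw]]; exact: zip_uniqr. Qed.

Lemma zip_path_edges (V : finType) (D : {set V * V}) x w :
  path (fun x y => (x, y) \in D) x w -> {subset zip (x :: w) w <= D}.
Proof.
elim: w x => [|y w IH] x //= /andP[xy pw] e; rewrite inE.
by case/predU1P => [->//|]; apply: IH.
Qed.

Lemma path_edges_sub (P : npath) :
  terminal_path P -> {subset path_edges P <= edges N}.
Proof. by case: P => [[s t] w] /and4P[_ pw _ _]; exact: zip_path_edges pw. Qed.

Lemma terminal_path_nonempty (P : npath) :
  terminal_path P -> exists e, e \in path_edges P.
Proof.
case: P => [[s t] [|y w]] /and4P[st _ /= /eqP E _]; last first.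
  by exists (term N s, y); rewrite /path_edges /= mem_head.
by rewrite (term_inj E) eqxx in st.
Qed.

Lemma sum_path_edges (f : node N * node N -> R) (P : npath) : terminal_path P ->
  \sum_(e in edges N | e \in path_edges P) f e = \sum_(e <- path_edges P) f e.
Proof.
move=> tP; rewrite (big_uniq _ (path_edges_uniq tP)) /=; apply: eq_bigl => e.
by apply: andb_idl; apply: path_edges_sub.
Qed.

Lemma terminal_paths_finite :
  exists Ps : {fset npath}, forall P : npath, terminal_path P -> P \in Ps.
Proof.
(* A simple path visits at most [#|node N|] nodes, which bounds the length of [w]. *)
pose ws := flatten [seq [seq val u | u <- enum {: k.-tuple (node N)}]
                    | k <- iota 0 #|node N|.+1].
exists [fset P in [seq (st, w) | st <- enum {: S * S}, w <- ws]]%fset => -[st w].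
case: st => s t /and4P[_ _ _ /= /andP[_ uw]]; rewrite inE.
apply/allpairsP; exists ((s, t), w); split=> //=; first by rewrite mem_enum.
apply/flattenP; exists [seq val u | u <- enum {: (size w).-tuple (node N)}].
  apply/mapP; exists (size w) => //; rewrite mem_iota /= add0n ltnS.
  by rewrite -(card_uniqP uw) max_card.
by apply/mapP; exists (in_tuple w); rewrite ?mem_enum.
Qed.

(** The program has a variable for each terminal path and a constraint for each edge; its dual
    variables are the lengths [l]. *)
Lemma multiflow_duality : exists Ps (lam : npath -> R) (l : node N * node N -> R),
  [/\ multiflow Ps lam, forall e, 0 <= l e,
    forall P, terminal_path P -> mu P.1.1 P.1.2 <= \sum_(e <- path_edges P) l e &
    \sum_(e in edges N) (cap N e)%:R * l e <= flow_value mu Ps lam].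
Proof.
have [Qs Hqs] := terminal_paths_finite.
pose Ps := [fset P in Qs | terminal_path P]%fset.
have PsE P : (P \in Ps) = terminal_path P.
  by rewrite !inE /=; apply: andb_idl; apply: Hqs.
pose A (e : node N * node N) (P : Ps) : R := (e \in path_edges (val P))%:R.
(* The rows range over all pairs of nodes; those outside [edges N] get capacity zero. *)
pose b e : R := if e \in edges N then (cap N e)%:R else 0.
pose c (P : Ps) : R := mu (val P).1.1 (val P).1.2.
have tP (P : Ps) : terminal_path (val P) by rewrite -PsE (valP P).
have AE (P : Ps) f : \sum_e A e P * f e = \sum_(e <- path_edges (val P)) f e.
  rewrite (big_uniq _ (path_edges_uniq (tP P))) [RHS]big_mkcond /=.
  by apply: eq_bigr => e _; rewrite /A; case: ifP; rewrite ?mul1r ?mul0r.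
have b_ge0 e : 0 <= b e by rewrite /b; case: ifP => // _; apply: ler0n.
(* The constant length [K] is dual feasible, as every terminal path has an edge. *)
pose K := \sum_s \sum_t mu s t.
have K_ge0 : 0 <= K by apply: sumr_ge0 => s _; apply: sumr_ge0.
have muK s t : mu s t <= K.
  rewrite /K (bigD1 s) //= (bigD1 t) //= -addrA lerDl.
  by apply: addr_ge0; apply: sumr_ge0 => // ? _; apply: sumr_ge0.
have [||||x [y [x_ge0 Ax y_ge0 Ay opt]]] :=
  @lp_duality _ _ _ A b c (fun=> 0) (fun=> K) => //.
- by move=> e; rewrite big1 // => P _; rewrite mulr0.
- move=> P; rewrite AE; have [e eP] := terminal_path_nonempty (tP P).
  rewrite (big_rem e eP) /=; apply: (le_trans (muK _ _)).
  by rewrite lerDl; apply: sumr_ge0.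
pose lam P : R := if insub P is Some u then x u else 0.
have lamE (P : Ps) : lam (val P) = x P by rewrite /lam valK.
exists Ps, lam, y; split=> // [|P|].
- split=> [P|P|e eN]; first by rewrite PsE.
    by move=> _; rewrite /lam; case: insub.
  rewrite big_seq_fsetE /=; have := Ax e; rewrite /b eN; apply: le_trans.
  rewrite big_mkcond /=; apply: ler_sum => P _.
  by rewrite /A lamE; case: ifP; rewrite ?mul1r ?mul0r.
- by rewrite -PsE => PP; have := Ay [` PP]%fset; rewrite AE.
- rewrite /flow_value big_seq_fsetE /=.
  have -> : \sum_(e in edges N) (cap N e)%:R * y e = \sum_e b e * y e.
    rewrite big_mkcond /=; apply: eq_bigr => e _.
    by rewrite /b; case: ifP; rewrite ?mul0r.
  by apply: (le_trans opt); apply: ler_sum => P _; rewrite lamE mulrC.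
Qed.

Lemma sum_edges_telescope (f : node N -> R) x w :
  f (last x w) - f x = \sum_(e <- zip (x :: w) w) (f e.2 - f e.1).
Proof.
elim: w x => [|y w IH] x /=; first by rewrite big_nil subrr.
by rewrite big_cons -IH /=; ring.
Qed.

(** Weak duality. Along a path from [s] to [t] the coordinate s^c rises from zero to at least
    [mu s t], since nonnegativity makes both coordinates of a terminal vanish at its own
    location. *)
Lemma flow_value_le_cost (A : set (crpoint R S)) Ps (lam : npath -> R)
    (rho : node N -> crpoint R S) :
  (A `<=` nonneg (P_ mu))%classic -> multiflow Ps lam -> location (N := N) A rho ->
  flow_value mu Ps lam <= location_cost (N := N) rho.
Proof.
move=> Asub [tP lam0 lamc] [Arho trho].
pose D (e : node N * node N) := Dinf (rho e.1) (rho e.2).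
apply: (@le_trans _ _ (\sum_(e in edges N)
    (\sum_(P <- Ps | e \in path_edges P) lam P) * D e)); last first.
  by apply: ler_sum => e eN; apply: ler_wpM2r; [exact: Dinf_ge0|exact: lamc].
have -> : \sum_(e in edges N) (\sum_(P <- Ps | e \in path_edges P) lam P) * D e =
    \sum_(P <- Ps) lam P * \sum_(e in edges N | e \in path_edges P) D e.
  under eq_bigr do rewrite mulr_suml.
  rewrite (exchange_big_dep xpredT) //=; apply: eq_bigr => P _.
  by rewrite mulr_sumr.
rewrite /flow_value big_seq_cond [X in _ <= X]big_seq_cond.
apply: ler_sum => P; rewrite andbT => PP; apply: ler_wpM2l; first exact: lam0.
rewrite (sum_path_edges _ (tP _ PP)); move: P PP => [[s t] w] PP /=.
have /and4P[_ _ /eqP lw _] := tP _ PP.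
apply: (@le_trans _ _ (rho (term N t) (inl s) - rho (term N s) (inl s))).
  have [_ zs] := trho s; have [/Asub[_ ps] _] := trho s.
  have [/Asub[Pt pt] zt] := trho t.
  by have := Pt s t; have := ps (inl s); have := ps (inr s);
     have := pt (inl t); have := pt (inr t); lra.
rewrite -lw (sum_edges_telescope (fun x => rho x (inl s))).
by apply: ler_sum => e _; have [+ _] := dist_le_Dinf (rho e.1) (rho e.2); apply.
Qed.

(** Collected by nodes, [a x] is multiplied by the incoming minus the outgoing capacity. *)
Lemma eulerian_potential (a : node N -> R) :
  (forall x, a x = 0 \/ eulerian_at x) ->
  \sum_(e in edges N) (cap N e)%:R * (a e.2 - a e.1) = 0.
Proof.
move=> H; under eq_bigr do rewrite mulrBr.
rewrite sumrB (partition_big snd xpredT) //=.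
rewrite [X in _ - X](partition_big fst xpredT) //= -sumrB big1 // => x _.
rewrite (eq_bigr (fun e => (cap N e)%:R * a x)); last by move=> e /andP[_ /eqP->].
rewrite [X in _ - X](eq_bigr (fun e => (cap N e)%:R * a x)); last first.
  by move=> e /andP[_ /eqP->].
rewrite -!mulr_suml -mulrBl; case: (H x) => [->|]; first by rewrite mulr0.
rewrite /eulerian_at => E; apply/eqP; rewrite mulf_eq0 subr_eq0.
by rewrite -!natr_sum E eqxx.
Qed.

Lemma dual_location (l : node N * node N -> R) : (forall s, mu s s = 0) ->
  (forall e, 0 <= l e) ->
  (forall P : npath, terminal_path P ->
     mu P.1.1 P.1.2 <= \sum_(e <- path_edges P) l e) ->
  exists rho : node N -> crpoint R S,
    [/\ forall x, P_ mu (rho x),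
        forall s, rho (term N s) (inl s) = 0 /\ rho (term N s) (inr s) = 0 &
        forall e, e \in edges N -> dist_le (rho e.1) (rho e.2) (l e)].
Proof.
move=> mu_diag l_ge0 Hl; pose K := \sum_s \sum_t mu s t.
have K_ge0 : 0 <= K by apply: sumr_ge0 => s _; apply: sumr_ge0.
have muK s t : mu s t <= K.
  rewrite /K (bigD1 s) //= (bigD1 t) //= -addrA lerDl.
  by apply: addr_ge0; apply: sumr_ge0 => // ? _; apply: sumr_ge0.
(* Truncation at [K] keeps the lower bounds, since no value of [mu] exceeds it. *)
pose d := trunc_dist (fun x y => (x, y) \in edges N) l K.
exists (fun x => join_point (fun s => d (term N s) x) (fun t => d x (term N t))).
split=> [x s t|s|e eN].
- rewrite !ffunE; have [<-|st] := eqVneq s t.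
    by rewrite mu_diag addr_ge0 //; apply: trunc_dist_ge0.
  apply: trunc_dist_cover => // w pw lw uw; apply: (Hl (s, t, w)).
  by apply/and4P; split=> //; apply/eqP.
- by rewrite !ffunE /d !trunc_dist_refl.
- case: e eN => x y xy /=; split=> s; rewrite !ffunE.
    exact: trunc_dist_edger.
  exact: trunc_dist_edgel.
Qed.

End MaxFlow.

(** * Optimal locations in nonnegative slimmed sections *)

Section Sections.
Variables (R : realType) (S : finType) (mu : S -> S -> R).
Hypothesis hmu : directed_distance mu.

Lemma slim_class_representative (A : set (crpoint R S)) p :
  slimmed_section_nonneg mu A -> Qslim mu p -> exists2 q, A q & slim_equiv mu q p.
Proof.
move=> [_ _ [_ _ surj] _] Qp; have [|q Aq E] := surj (slim_class mu p).
  by exists p.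
exists q => //; have [] // : slim_class mu q p.
by rewrite E; split=> //; left; exists 0; apply/ffunP => -[] s; rewrite !ffunE; lra.
Qed.

(** Supplies the default terminal for [conjugate]. If [S] were empty, strict inequalities would hold
    vacuously and balancedness would force [A] to be empty, although the only point is slim and
    needs a representative. *)
Lemma slimmed_section_terminals (A : set (crpoint R S)) :
  slimmed_section_nonneg mu A -> exists s : S, True.
Proof.
move=> secA; apply: contrapT => S_empty.
have empty (s : S) : False by apply: S_empty; exists s.
pose p : crpoint R S := [ffun=> 0].
have Qp : Q_ mu p by split=> [s|q _ _]; [case: (empty s)|apply/ffunP => -[s|s]; case: (empty s)].
have [|q Aq _] := slim_class_representative secA (p := p).
  by apply: (Qslim_escapes_r hmu) => // s; case: (empty s).
by have [bal _ _ _] := secA; have [+ _] := bal q q Aq Aq; apply=> s; case: (empty s).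
Qed.

Lemma slim_location (A : set (crpoint R S)) (N : network S)
    (l : node N * node N -> R) :
  slimmed_section_nonneg mu A -> properly_inner_eulerian mu N ->
  (forall e, 0 <= l e) ->
  (forall P : S * S * seq (node N), terminal_path P ->
     mu P.1.1 P.1.2 <= \sum_(e <- path_edges P) l e) ->
  exists2 rho, location (N := N) A rho &
    location_cost (N := N) rho <= \sum_(e in edges N) (cap N e)%:R * l e.
Proof.
move=> secA pieN l_ge0 lmu; have [mu_ge0 mu_diag] := hmu.
have [s0 _] := slimmed_section_terminals secA.
have [rho0 [P0 T0 D0]] := dual_location mu_ge0 mu_diag l_ge0 lmu.
(* Double conjugation retracts to Q_mu and preserves the bounds [l] on the directed distances. *)
pose c1 x := conjugate (transpose mu) s0 (rpart (rho0 x)).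
pose r1 x := conjugate mu s0 (c1 x).
pose rho1 x := join_point (c1 x) (r1 x).
have Q1 x : Q_ mu (rho1 x).
  apply/(Q_minimal_pair mu); rewrite cpart_join rpart_join.
  exact: minimal_pair_retract.
have D1 e : e \in edges N -> dist_le (rho1 e.1) (rho1 e.2) (l e).
  move=> /D0[_ Dr].
  have H1 := conjugate_contract (transpose mu) s0 Dr.
  have H2 := conjugate_contract mu s0 H1.
  by split=> s; rewrite !ffunE; [exact: H1|exact: H2].
have T1 s : rho1 (term N s) (inl s) = 0 /\ rho1 (term N s) (inr s) = 0.
  have [zc zr] := T0 s; have := P_point s s (Q1 (term N s)).
  rewrite !ffunE mu_diag => sum_ge0.
  have : c1 (term N s) s <= 0.
    rewrite -zc; apply: conjugate_le => t.
    by have := P0 (term N s) s t; rewrite /transpose /rpart; lra.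
  have : r1 (term N s) s <= 0.
    rewrite -zr; apply: conjugate_le => u.
    have := conjugate_ge (transpose mu) s0 (rpart (rho0 (term N s))) s u.
    by rewrite -/(c1 (term N s)) /transpose /rpart; lra.
  by lra.
have [F [slimF DF]] := slimming hmu.
have /choice[f Hf] x : exists y : crpoint R S * R * R * {set S},
    let: (q, a, b, X) := y in
    [/\ A q, 0 <= b,
      b = 0 \/ [/\ X = tight_set q, Qdeg mu X (F (rho1 x)) & Qdeg mu X q],
      forall s, q (inl s) = F (rho1 x) (inl s) + a + b * (s \in X)%:R &
      forall s, q (inr s) = F (rho1 x) (inr s) - a - b * (s \in X)%:R].
  have [slim esc _ _] := slimF _ (Q1 x).
  have [q Aq /(slim_representative hmu esc)[a [b [X [? ? ? ?]]]]] :=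
    slim_class_representative secA slim.
  by exists (q, a, b, X).
pose rho x := (f x).1.1.1; pose a x := (f x).1.1.2.
pose b x := (f x).1.2; pose X x := (f x).2.
have {}Hf x : [/\ A (rho x), 0 <= b x,
      b x = 0 \/ [/\ X x = tight_set (rho x), Qdeg mu (X x) (F (rho1 x)) &
                     Qdeg mu (X x) (rho x)],
      forall s, rho x (inl s) = F (rho1 x) (inl s) + a x + b x * (s \in X x)%:R &
      forall s, rho x (inr s) = F (rho1 x) (inr s) - a x - b x * (s \in X x)%:R].
  by have := Hf x; rewrite /rho /a /b /X; case: (f x) => -[[]].
exists rho.
  split=> [x|s]; first by have [] := Hf x.
  split; first by have [] := Hf (term N s).
  have [_ _ _ -> ->] := Hf (term N s).
  have [_ _ /(_ s) tF _] := slimF _ (Q1 (term N s)).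
  have /eqP : tight (F (rho1 (term N s))) s.
    by apply: tF; rewrite /tight; have [-> ->] := T1 s; rewrite addr0.
  by lra.
(* At a proper terminal the point [rho1 x] is no fat, so [F] fixes it and [b x = 0]. The coordinates
   of the representative at this terminal are then [a x] and [- a x], both nonnegative. *)
have pot x : a x = 0 \/ eulerian_at x.
  have [|/pieN nproper] := pselect (exists s, x = term N s /\ proper_terminal mu s);
    last by right.
  case=> s [xs prop]; left.
  have [T1c T1r] := T1 s; rewrite -xs in T1c T1r.
  have nfat : ~ (fat_c mu (rho1 x) \/ fat_r mu (rho1 x)).
    move=> F1; apply: prop; exists (rho1 x), (tight_set (rho1 x)); split.
    - by split=> //; rewrite T1c T1r addr0.
    - exact: S0_tight_set.
    - exact/fat_tight_set.
  have [_ _ _ FE] := slimF _ (Q1 x).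
  have {}FE : F (rho1 x) = rho1 x by apply: FE => ?; apply: nfat; auto.
  have [Ax _ degx Ec Er] := Hf x.
  have bx : b x = 0.
    case: degx => // -[_ degF _]; case: nfat.
    move: degF; rewrite FE => /(Qdeg_tight_set hmu _ (Q1 x))[_].
    by case=> -[? _]; [left|right].
  have [_ /(_ _ Ax)[_ pos] _ _] := secA.
  have := pos (inl s); have := pos (inr s).
  by rewrite Ec Er FE T1c T1r bx !mul0r; lra.
apply: (@le_trans _ _ (\sum_(e in edges N)
    ((cap N e)%:R * l e + (cap N e)%:R * (a e.2 - a e.1)))); last first.
  by rewrite big_split /= eulerian_potential // addr0.
apply: ler_sum => e eN; rewrite -mulrDr; apply: ler_wpM2l; first exact: ler0n.
have [A1 b1 _ Ec1 _] := Hf e.1; have [A2 b2 deg2 Ec2 _] := Hf e.2.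
apply: (slimmed_section_dist hmu secA A1 A2 b2 (X := X e.2)).
  by case: deg2 => [|[]]; auto.
(* The shift by [b e.2] is allowed for by [slimmed_section_dist], and the one by [b e.1] only lowers
   the difference. *)
move=> s; rewrite Ec1 Ec2; have [/(_ s) Ds _] := DF _ _ _ (D1 _ eN).
have : 0 <= b e.1 * (s \in X e.1)%:R by apply: mulr_ge0 => //; apply: ler0n.
by move: Ds; lra.
Qed.

(** The flow value bounds the cost of [l], this bounds the cost of [rho], and weak duality closes
    the chain, so both optima are attained. *)
Lemma slimmed_section_nonneg_MFP_eq_FLP (A : set (crpoint R S)) (N : network S) :
  slimmed_section_nonneg mu A -> properly_inner_eulerian mu N -> MFP_eq_FLP mu A N.
Proof.
move=> secA pieN; have [mu_ge0 _] := hmu.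
have [Ps [lam [l [flow l_ge0 lmu opt]]]] := multiflow_duality N mu_ge0.
have [rho loc cost] := slim_location secA pieN l_ge0 lmu.
have Asub : (A `<=` nonneg (P_ mu))%classic.
  by case: secA => _ sub _ _ p /sub[[[]]].
exists (flow_value mu Ps lam); split; split.
- by exists Ps, lam.
- move=> _ [Ps' [lam' [flow' ->]]].
  apply: le_trans opt; apply: le_trans cost.
  exact: flow_value_le_cost Asub flow' loc.
- exists rho; split=> //; apply/le_anti/andP; split.
    exact: flow_value_le_cost Asub flow loc.
  exact: le_trans opt.
- by move=> _ [rho' [loc' ->]]; apply: flow_value_le_cost Asub flow loc'.
Qed.

End Sections.

(** * Moving locations along L *)

Section Shift.
Variables (R : realType) (S : finType).

Lemma balanced_pair (A : set (crpoint R S)) p q :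
  balanced A -> A p -> A q -> exists s, p (inl s) <= q (inl s).
Proof.
move=> bal Ap Aq; apply: contrapT => H; have [+ _] := bal _ _ Aq Ap; apply=> s.
by rewrite ltNge; apply/negP => Hs; apply: H; exists s.
Qed.

(** The shifts change the bound in [dist_le] by exactly [b - a]; the last hypothesis makes the new
    bound nonnegative, as [Dinf] requires. *)
Lemma Dinf_shift_le (p q p' q' : crpoint R S) a b :
  (forall s, p' (inl s) = p (inl s) + a) -> (forall s, p' (inr s) = p (inr s) - a) ->
  (forall s, q' (inl s) = q (inl s) + b) -> (forall s, q' (inr s) = q (inr s) - b) ->
  (exists s, p' (inl s) <= q' (inl s)) -> Dinf p' q' <= Dinf p q + b - a.
Proof.
move=> pc pr qc qr [s0 H0]; have [Hc Hr] := dist_le_Dinf p q.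
apply/Dinf_le; split.
  by have := Hc s0; move: H0; rewrite pc qc; lra.
by split=> s; [have := Hc s; rewrite pc qc|have := Hr s; rewrite pr qr]; lra.
Qed.

(** Balancedness of both sets gives [Dinf_shift_le] in both directions, hence an equality, and the
    potential differences cancel over the edges. *)
Lemma shift_location (A B : set (crpoint R S)) (N : network S)
    (rho : node N -> crpoint R S) :
  balanced A -> balanced B -> mod_line A = mod_line B -> totally_eulerian N ->
  location A rho ->
  exists2 rho', location (N := N) B rho' &
    location_cost (N := N) rho' = location_cost (N := N) rho.
Proof.
move=> balA balB AB eul [Arho trho].
have /choice[f Hf] x : exists y : crpoint R S * R, [/\ B y.1,
    forall s, y.1 (inl s) = rho x (inl s) + y.2 &
    forall s, y.1 (inr s) = rho x (inr s) - y.2].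
  have : mod_line A (coset_line (rho x)) by exists (rho x).
  rewrite AB => -[q Bq E].
  have : coset_line (rho x) q.
    rewrite -E; exists 0; apply/ffunP => -[] s; rewrite !ffunE; lra.
  case=> a Ea; exists (q, a); split=> //= s.
    have := congr1 (fun g : crpoint R S => g (inl s)) Ea.
    by rewrite !ffunE !inE /= => ?; lra.
  have := congr1 (fun g : crpoint R S => g (inr s)) Ea.
  by rewrite !ffunE !inE /= => ?; lra.
exists (fun x => (f x).1).
  split=> [x|s]; first by have [] := Hf x.
  have [Bf Ec Er] := Hf (term N s); have [_ z] := trho s.
  by split=> //; rewrite Ec Er; lra.
have DE e : Dinf (f e.1).1 (f e.2).1 =
    Dinf (rho e.1) (rho e.2) + ((f e.2).2 - (f e.1).2).
  have [B1 c1 r1] := Hf e.1; have [B2 c2 r2] := Hf e.2.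
  have := Dinf_shift_le c1 r1 c2 r2 (balanced_pair balB B1 B2).
  have : Dinf (rho e.1) (rho e.2) <=
      Dinf (f e.1).1 (f e.2).1 + - (f e.2).2 - - (f e.1).2.
    apply: Dinf_shift_le; last exact: balanced_pair (Arho _) (Arho _).
    - by move=> s; rewrite c1; lra.
    - by move=> s; rewrite r1; lra.
    - by move=> s; rewrite c2; lra.
    - by move=> s; rewrite r2; lra.
  by move=> ? ?; apply/le_anti/andP; split; lra.
rewrite /location_cost; under eq_bigr do rewrite DE mulrDr.
rewrite big_split /= (eulerian_potential (a := fun x => (f x).2)) ?addr0 //.
by move=> x; right; apply: eul.
Qed.

End Shift.

Theorem theorem2p4 (R : realType) (S : finType) (mu : S -> S -> R)
    (hmu : directed_distance mu) :
  (forall (A : set (crpoint R S)) (N : network S),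
     slimmed_section_nonneg mu A -> properly_inner_eulerian mu N ->
     MFP_eq_FLP mu A N) /\
  (forall (A : set (crpoint R S)) (N : network S),
     slimmed_section mu A -> totally_eulerian N ->
     MFP_eq_FLP mu A N).
Proof.
split=> A N; first exact: slimmed_section_nonneg_MFP_eq_FLP.
move=> [balA _ _ [B [secB AB]]] eul.
have [balB _ _ _] := secB.
have [v [mfp [[rho [loc E]] lb]]] :
    MFP_eq_FLP mu B N by apply: slimmed_section_nonneg_MFP_eq_FLP => // x _.
exists v; split=> //; split.
  have [rho' loc' cost'] := shift_location balB balA (esym AB) eul loc.
  by exists rho'; rewrite cost'.
move=> _ [rho' [loc' ->]].
have [rho'' loc'' <-] := shift_location balA balB AB eul loc'.
by apply: lb; exists rho''.
Qed.
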